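(* Let $\mathbb{K}=\mathbb{R}$ or $\mathbb{C}$. Let $X$ be a compact affine real algebraic variety with the property that every topological $\mathbb{K}$-vector bundle of rank $k$ over $X$ is topologically isomorphic to an algebraic $\mathbb{K}$-vector bundle. Then the inclusion $$i:\mathrm{Alg}(X,\mathbb{G}_{n,k}(\mathbb{K}))\to \mathrm{Map}(X,\mathbb{G}_{n,k}(\mathbb{K}))$$ is a weak homotopy equivalence.
   Context: $\mathbb{G}_{n,k}(\mathbb{K})$ is the Grassmannian manifold of $k$-dimensional $\mathbb{K}$-subspaces of $\mathbb{K}^n$; it is regarded (also for $\mathbb{K}=\mathbb{C}$) as a real affine algebraic variety in the usual way (e.g. identifying a subspace with the orthogonal projection matrix onto it). If $U$ is a Zariski open subset of an algebraic set $V$, a function on $U$ is regular if it can be written as a quotient of two polynomials $g/h$ with $h^{-1}(0)\cap U=\emptyset$; an algebraic (i.e. regular) map is one whose coordinate functions are regular. $\mathrm{Map}(X,\mathbb{G}_{n,k}(\mathbb{K}))$ is the space of all continuous maps (compact-open topology, with the Euclidean topologies on $X$ and the Grassmannian), and $\mathrm{Alg}(X,\mathbb{G}_{n,k}(\mathbb{K}))$ is its subspace of all algebraic maps. A pre-algebraic $\mathbb{K}$-vector bundle over a real algebraic variety $X$ is a triple $(E,p,X)$ with $E$ a real algebraic variety and $p:E\to X$ an algebraic map, such that each fiber is a $\mathbb{K}$-vector space and $X$ has a covering by Zariski open sets over which $E$ is biregularly isomorphic to a trivial bundle. An algebraic $\mathbb{K}$-vector bundle is a pre-algebraic one that is algebraically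 isomorphic to a pre-algebraic vector sub-bundle of a trivial bundle. *)

(* Defs.v *)
From HB Require Import structures.
From mathcomp Require Import all_boot all_order all_algebra.
From mathcomp Require Import all_classical all_reals all_analysis.
From mathcomp Require complex.
Import (canonicals) complex.
(* not imported: the notations of mpoly clash with those of the analysis
   library *)
From mathcomp Require mpoly.

Set Implicit Arguments.
Unset Strict Implicit.
Unset Printing Implicit Defensive.

Import Order.TTheory GRing.Theory Num.Theory.
Import numFieldNormedType.Exports.
Local Open Scope classical_set_scope.
Local Open Scope ring_scope.

Inductive ground := RealNumbers | ComplexNumbers.

Section GroundField.
Context {R : realType}.

Definition ground_field (s : ground) : numFieldType :=
  match s with
  | RealNumbers => R
  | ComplexNumbers => complex.complex R
  end.

Definition repart (s : ground) : ground_field s -> R :=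
  match s with
  | RealNumbers => fun x => x
  | ComplexNumbers => fun z => complex.Re z
  end.

Definition impart (s : ground) : ground_field s -> R :=
  match s with
  | RealNumbers => fun=> 0
  | ComplexNumbers => fun z => complex.Im z
  end.

Definition conjugate (s : ground) : ground_field s -> ground_field s :=
  match s with
  | RealNumbers => fun x => x
  | ComplexNumbers => fun z => complex.Complex (complex.Re z) (- complex.Im z)
  end.

(* Real coordinates on K^N. For K = R the last N coordinates are all 0, so the
   image is the algebraic set R^N x {0}. *)
Definition realify (s : ground) (N : nat) (v : 'rV[ground_field s]_N) :
    'rV[R]_(N + N) :=
  row_mx (map_mx (@repart s) v) (map_mx (@impart s) v).

End GroundField.
Arguments ground_field : clear implicits.

Section Varieties.
Context {R : realType}.

Definition peval (N : nat) (p : mpoly.mpoly N R) (x : 'rV[R]_N) : R :=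
  mpoly.meval (fun i => x ord0 i) p.

Definition algebraic_set (N : nat) (Z : set 'rV[R]_N) : Prop :=
  exists P : set (mpoly.mpoly N R),
    Z = [set x | forall p, P p -> peval p x = 0].

(* A set with a family of "Zariski open" subsets and, for each open subset U,
   a set of "regular" functions on U. Functions on U are represented by total
   functions, only the values on U being relevant. *)
Record fspace := FSpace {
  points :> choiceType ;
  zopen : set (set points) ;
  regular : set points -> set (points -> R)
}.

(* The structure induced on T by a map c to R^N: with c the inclusion of an
   algebraic set (or of a Zariski open subset of one), open sets are the
   relatively Zariski open ones and regular functions are the quotients of
   polynomials with non-vanishing denominator. *)
Definition rational_on (T : Type) (N : nat) (c : T -> 'rV[R]_N)
    (W : set T) (f : T -> R) : Prop :=
  exists g h : mpoly.mpoly N R, forall x, W x ->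
    peval h (c x) != 0 /\ f x = peval g (c x) / peval h (c x).

Definition embedded (T : choiceType) (N : nat) (c : T -> 'rV[R]_N) : fspace :=
  @FSpace T
    [set W | exists2 Z, algebraic_set Z & W = ~` (c @^-1` Z)]
    (fun W => [set f | rational_on c W f]).

(* The open subspace U is isomorphic, through c, to the algebraic set V. *)
Definition affine_open (E : fspace) (U : set E) : Prop :=
  zopen U /\
  exists (N : nat) (V : set 'rV[R]_N) (c : E -> 'rV[R]_N),
    [/\ algebraic_set V, set_bij U V c,
        forall W, W `<=` U ->
          (zopen W <->
           exists2 Z, algebraic_set Z & W = U `&` ~` (c @^-1` Z))
      & forall W f, W `<=` U -> zopen W ->
          (regular W f <-> rational_on c W f)].

(* A topological space with a sheaf of real-valued functions, covered by
   finitely many affine open subspaces. *)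
Record is_variety (E : fspace) : Prop := IsVariety {
  zopenT : zopen [set: E] ;
  zopenI : setI_closed (@zopen E) ;
  zopen_bigcup : forall (I : Type) (U : I -> set E),
    (forall i, zopen (U i)) -> zopen (\bigcup_i U i) ;
  regular_restrict : forall (U W : set E) (f g : E -> R),
    zopen U -> zopen W -> W `<=` U -> {in W, f =1 g} ->
    regular U f -> regular W g ;
  regular_glue : forall (U : set E) (f : E -> R), zopen U ->
    (forall x, U x -> exists W, [/\ zopen W, W x, W `<=` U & regular W f]) ->
    regular U f ;
  affine_cover : exists (d : nat) (U : 'I_d -> set E),
    (forall i, affine_open (U i)) /\ \bigcup_i U i = setT
}.

(* f restricted to the Zariski open set W is an algebraic map to F. *)
Definition algebraic_on (E F : fspace) (W : set E) (f : E -> F) : Prop :=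
  forall O : set F, zopen O ->
    zopen (W `&` f @^-1` O) /\
    forall g, regular O g -> regular (W `&` f @^-1` O) (g \o f).

Definition euclidean (E : fspace) : Type := E.

HB.instance Definition _ (E : fspace) := Choice.on (euclidean E).

(* The Euclidean topology of a variety is the coarsest one for which Zariski
   open sets are open and regular functions are continuous. *)
Definition euclidean_subbase (E : fspace) : set (set (euclidean E)) :=
  [set O | exists (U : set E) (f : E -> R),
     [/\ zopen U, regular U f & O = U `&` [set x | 0 < f x]]].

HB.instance Definition _ (E : fspace) :=
  isSubBaseTopological.Build (euclidean E) (@euclidean_subbase E) id.

End Varieties.
Arguments fspace : clear implicits.

(* A map p : T -> X whose fibers are K-vector spaces: vpt x identifies the
   vector space vfiber x with the fiber of p over x. *)
Record vfamily (K : numFieldType) (T X : Type) := VFamily {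
  vproj : T -> X ;
  vfiber : X -> lmodType K ;
  vpt : forall x, vfiber x -> T ;
  vpt_bij : forall x, set_bij setT (vproj @^-1` [set x]) (@vpt x)
}.

Section Families.
Context {K : numFieldType} {X : Type}.

(* phi and psi are mutually inverse fiberwise linear bijections between the
   part of T over U and U x K^k. *)
Definition trivialization (T : Type) (xi : vfamily K T X) (k : nat)
    (U : set X) (phi : T -> X * 'rV[K]_k) (psi : X * 'rV[K]_k -> T) : Prop :=
  [/\ forall e, U (vproj xi e) ->
        (phi e).1 = vproj xi e /\ psi (phi e) = e,
      forall x v, U x ->
        vproj xi (psi (x, v)) = x /\ phi (psi (x, v)) = (x, v)
    & forall x, U x -> linear (fun v : vfiber xi x => (phi (vpt v)).2)].

Definition bundle_map (T T' : Type) (xi : vfamily K T X) (eta : vfamily K T' X)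
    (f : T -> T') : Prop :=
  (forall e, vproj eta (f e) = vproj xi e) /\
  forall x, exists l : {linear vfiber xi x -> vfiber eta x},
    forall v, f (vpt v) = vpt (l v).

End Families.

Definition topological_bundle (K : numFieldType) (X T : topologicalType)
    (k : nat) (xi : vfamily K T X) : Prop :=
  continuous (vproj xi) /\
  forall x : X, exists (U : set X) (phi : T -> X * 'rV[K]_k)
      (psi : X * 'rV[K]_k -> T),
    [/\ open U /\ U x,
        trivialization xi U phi psi,
        {within vproj xi @^-1` U, continuous phi}
      & {within U `*` setT, continuous psi}].

Section AlgebraicBundles.
Context {R : realType} (s : ground) {m : nat} (V : set 'rV[R]_m).
Local Notation K := (ground_field R s).

Definition base : fspace R := @embedded R V m set_val.

Definition base_times (N : nat) : fspace R :=
  @embedded R (V * 'rV[K]_N)%type (m + (N + N))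
    (fun z => row_mx (set_val z.1) (realify z.2)).

Definition prealgebraic_bundle (k : nat) (E : fspace R) (xi : vfamily K E V) :
    Prop :=
  [/\ is_variety E,
      @algebraic_on R E base setT (vproj xi)
    & forall x : V, exists (U : set V) (phi : E -> V * 'rV[K]_k)
        (psi : V * 'rV[K]_k -> E),
      [/\ @zopen R base U /\ U x,
          trivialization xi U phi psi,
          @algebraic_on R E (base_times k) (vproj xi @^-1` U) phi
        & @algebraic_on R (base_times k) E (U `*` setT) psi]].

Definition subspace_of_times (N : nat) (S : set (V * 'rV[K]_N)) : fspace R :=
  @embedded R S (m + (N + N))
    (fun z => row_mx (set_val (set_val z).1) (realify (set_val z).2)).

(* A pre-algebraic sub-bundle of V x K^N: a pre-algebraic bundle whose total
   space is a subset of V x K^N with the induced structure, and whose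
   projection and vector space operations are those of V x K^N. *)
Definition prealgebraic_subbundle (k N : nat) (S : set (V * 'rV[K]_N))
    (xi : vfamily K S V) : Prop :=
  [/\ @prealgebraic_bundle k (subspace_of_times S) xi,
      forall z : S, vproj xi z = (set_val z).1
    & forall x, linear (fun v : vfiber xi x => (set_val (vpt v)).2)].

Definition algebraically_isomorphic (E F : fspace R)
    (xi : vfamily K E V) (eta : vfamily K F V) : Prop :=
  exists (f : E -> F) (g : F -> E),
    [/\ cancel f g, cancel g f, bundle_map xi eta f,
        algebraic_on setT f & algebraic_on setT g].

Definition algebraic_bundle (k : nat) (E : fspace R) (xi : vfamily K E V) :
    Prop :=
  prealgebraic_bundle k xi /\
  exists (N : nat) (S : set (V * 'rV[K]_N)) (eta : vfamily K S V),
    prealgebraic_subbundle k eta /\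
    @algebraically_isomorphic E (subspace_of_times S) xi eta.

End AlgebraicBundles.

Definition topologically_isomorphic (K : numFieldType) (X : Type)
    (T T' : topologicalType) (xi : vfamily K T X) (eta : vfamily K T' X) :
    Prop :=
  exists (f : T -> T') (g : T' -> T),
    [/\ cancel f g, cancel g f, bundle_map xi eta f,
        continuous f & continuous g].

Definition Map (X Y : topologicalType) : Type := continuousType X Y.

Definition fun_of_Map (X Y : topologicalType) (f : Map X Y) : X -> Y :=
  Continuous.sort f.
Coercion fun_of_Map : Map >-> Funclass.

HB.instance Definition _ (X Y : topologicalType) :=
  Choice.copy (Map X Y) (continuousType X Y).
HB.instance Definition _ (X Y : topologicalType) :=
  Topological.copy (Map X Y)
    (initial_topology (@fun_of_Map X Y : Map X Y -> {compact-open, X -> Y})).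

(* A subspace is identified with the orthogonal projection onto it. *)
Definition grassmannian (R : realType) (s : ground) (n k : nat) :
    set 'M[ground_field R s]_n :=
  [set P | [/\ P *m P = P, (map_mx (@conjugate R s) P)^T = P & \rank P = k]].
Arguments grassmannian : clear implicits.

Definition Alg (R : realType) (s : ground) (m : nat) (V : set 'rV[R]_m)
    (n k : nat) : set (Map V (grassmannian R s n k)) :=
  [set f : Map V (grassmannian R s n k) | forall i j,
     @regular R (base V) setT (fun x => repart (set_val (f x) i j)) /\
     @regular R (base V) setT (fun x => impart (set_val (f x) i j))].
Arguments Alg {R} s {m} V n k.

Section Homotopy.
Variable R : realType.

Definition cube (n : nat) : set 'rV[R]_n :=
  [set t | forall i, 0 <= t ord0 i <= 1].

Definition cube_boundary (n : nat) : set 'rV[R]_n :=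
  [set t | cube t /\ exists i, t ord0 i = 0 \/ t ord0 i = 1].

Definition path_connected_to (A : topologicalType) (a b : A) : Prop :=
  exists c : R -> A, [/\ {within `[0, 1], continuous c}, c 0 = a & c 1 = b].

(* Representatives of elements of the n-th homotopy group of (A, a), and
   equality of the elements that they represent. *)
Definition sphere_map (A : topologicalType) (a : A) (n : nat)
    (u : 'rV[R]_n -> A) : Prop :=
  {within @cube n, continuous u} /\ forall t, cube_boundary t -> u t = a.

Definition sphere_homotopic (A : topologicalType) (a : A) (n : nat)
    (u v : 'rV[R]_n -> A) : Prop :=
  exists H : 'rV[R]_n * R -> A,
    [/\ {within @cube n `*` `[0, 1], continuous H},
        forall t, cube t -> H (t, 0) = u t,
        forall t, cube t -> H (t, 1) = v t
      & forall t r, cube_boundary t -> 0 <= r <= 1 -> H (t, r) = a].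

(* f induces a bijection on path components and, for every base point,
   isomorphisms on the homotopy groups of positive degree; the induced maps
   always being homomorphisms, only their bijectivity has to be asserted. *)
Definition weak_homotopy_equivalence (A B : topologicalType) (f : A -> B) :
    Prop :=
  [/\ continuous f,
      forall b, exists a, path_connected_to (f a) b,
      forall a a', path_connected_to (f a) (f a') -> path_connected_to a a',
      forall (n : nat) (a : A) (u v : 'rV[R]_n -> A), (0 < n)%N ->
        sphere_map a u -> sphere_map a v ->
        sphere_homotopic (f a) (f \o u) (f \o v) -> sphere_homotopic a u v
    & forall (n : nat) (a : A) (w : 'rV[R]_n -> B), (0 < n)%N ->
        sphere_map (f a) w ->
        exists u, sphere_map a u /\ sphere_homotopic (f a) (f \o u) w].

End Homotopy.

(* Main.v *)
(* A map X -> G(n, k) is the same as a rank k bundle xi over X together with an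
   injection of xi into the trivial bundle X x K^n. Let F be a family of maps
   parametrized by a ball, algebraic on the boundary sphere. The bundle of its
   central map is, by hypothesis, topologically isomorphic to an algebraic
   sub-bundle xi of some X x K^N, whose orthogonal projection e is regular.
   Parallel transport along the radii gives continuous injections u_t of xi with
   image F_t. By the Stone-Weierstrass theorem u_t is uniformly close to a family
   v_t which is polynomial in x. The image of a small perturbation w_t of u_t is
   the projection w^* (w w^* + 1 - e)^-1 w, which is regular as soon as w is, and
   the segment from u_t to w_t gives a homotopy. To fix the boundary, expand the
   ball radially so that F is algebraic on a collar, and compose v_t with a
   combination of F_t and the identity, equal to F_t on the sphere and to the
   identity outside of the collar. *)
From HB Require Import structures.
Require Import Defs.
From mathcomp Require Import all_boot all_order all_algebra.
From mathcomp Require Import all_classical all_reals all_analysis.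
From mathcomp Require complex mpoly.
From mathcomp Require Import ring lra.
Import (canonicals) complex.
Import (canonicals, coercions) mpoly.
Import numFieldNormedType.Exports.

Set Implicit Arguments.
Unset Strict Implicit.
Unset Printing Implicit Defensive.

Import Order.TTheory GRing.Theory Num.Theory.
Local Open Scope classical_set_scope.
Local Open Scope ring_scope.

(** * Real coordinates on the ground field *)

(** All clauses of a weak homotopy equivalence are instances of one relative statement: a map from a
    ball to [Map] which is algebraic on the sphere deforms, with the sphere fixed, to a map into
    [Alg]. The balls needed are those of a zero-dimensional space, of [R], of ['rV[R]_d * R] and of
    ['rV[R]_d], which is why the deformation is built over an abstract normed space with compact
    unit ball.

    The obstacle is the boundary. Even where [F_t] is regular the frame [u_t] is not, since it comes
    from a merely continuous isomorphism and from transport; hence [w_t] cannot be asked to equal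
    [u_t] on the sphere. But only its image matters, and by counting ranks this image is [F_t] as
    soon as the rows of [w_t] lie in [F_t]. Multiplying the perturbation on the right by [F_t]
    ensures this without spoiling regularity, provided that [F_t] is regular; in the interior it is
    not, whence the passage to the identity across a collar.

    Invertibility of a matrix is an open condition that holds for the unperturbed data; compactness
    of ball times [X] then gives uniform sizes for the transport steps and for the perturbation. *)

Section GroundField.
Context {R : realType} (s : ground).
Local Notation K := (ground_field R s).
Local Notation re := (@repart R s).
Local Notation im := (@impart R s).
Local Notation conj := (@conjugate R s).

(** For [RealNumbers] the second argument is discarded, so the imaginary part of the result is
    recorded below only when it is 0, the case of the real scalars [of_parts s a 0]. *)
Definition of_parts (a b : R) : K :=
  match s return ground_field R s with
  | RealNumbers => a
  | ComplexNumbers => complex.Complex a b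
  end.

Lemma of_partsK (z : K) : of_parts (re z) (im z) = z.
Proof. by rewrite /of_parts; case: s z => //= -[]. Qed.

Lemma re_of_parts a b : re (of_parts a b) = a.
Proof. by rewrite /of_parts; case: s. Qed.

Lemma im_of_parts0 a : im (of_parts a 0) = 0.
Proof. by rewrite /of_parts; case: s. Qed.

Lemma parts_inj (x y : K) : re x = re y -> im x = im y -> x = y.
Proof. by move=> h h'; rewrite -[x]of_partsK -[y]of_partsK h h'. Qed.

Lemma reD (x y : K) : re (x + y) = re x + re y.
Proof. by move: x y; case: s => //= -[? ?] [? ?]. Qed.

Lemma imD (x y : K) : im (x + y) = im x + im y.
Proof. by move: x y; case: s => /= [? ?|[? ?] [? ?]]//; rewrite addr0. Qed.

Lemma reN (x : K) : re (- x) = - re x.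
Proof. by move: x; case: s => //= -[? ?]. Qed.

Lemma imN (x : K) : im (- x) = - im x.
Proof. by move: x; case: s => /= [?|[? ?]]//; rewrite oppr0. Qed.

Lemma reM (x y : K) : re (x * y) = re x * re y - im x * im y.
Proof. by move: x y; case: s => /= [? ?|[? ?] [? ?]]//; rewrite mul0r subr0. Qed.

Lemma imM (x y : K) : im (x * y) = re x * im y + im x * re y.
Proof. by move: x y; case: s => /= [? ?|[? ?] [? ?]]//; rewrite mul0r mulr0 addr0. Qed.

Lemma re0 : re 0 = 0. Proof. by case: s. Qed.
Lemma im0 : im 0 = 0. Proof. by case: s. Qed.
Lemma re1 : re 1 = 1. Proof. by case: s. Qed.
Lemma im1 : im 1 = 0. Proof. by case: s. Qed.

Lemma re_conj x : re (conj x) = re x. Proof. by move: x; case: s. Qed.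
Lemma im_conj x : im (conj x) = - im x.
Proof. by move: x; case: s => //= _; rewrite oppr0. Qed.

Lemma conjK : involutive conj.
Proof. by move=> x; apply: parts_inj; rewrite !(re_conj, im_conj, opprK). Qed.

Lemma conj_is_zmod_morphism : zmod_morphism conj.
Proof.
move=> x y; apply: parts_inj; rewrite !(re_conj, im_conj, reD, imD, reN, imN) //.
by rewrite opprD.
Qed.

Lemma conj_is_monoid_morphism : monoid_morphism conj.
Proof.
split=> [|x y]; apply: parts_inj.
- by rewrite re_conj.
- by rewrite im_conj im1 oppr0.
- by rewrite !(re_conj, im_conj, reM) mulrNN.
- by rewrite !(re_conj, im_conj, imM) mulrN mulNr opprD.
Qed.

HB.instance Definition _ := GRing.isZmodMorphism.Build K K conj
  conj_is_zmod_morphism.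
HB.instance Definition _ := GRing.isMonoidMorphism.Build K K conj
  conj_is_monoid_morphism.

Lemma of_parts0 : of_parts 0 0 = 0.
Proof. by apply: parts_inj; rewrite ?re_of_parts ?im_of_parts0 ?re0 ?im0. Qed.

Lemma of_parts1 : of_parts 1 0 = 1.
Proof. by apply: parts_inj; rewrite ?re_of_parts ?im_of_parts0 ?re1 ?im1. Qed.

Definition sqmod (x : K) : R := re x ^+ 2 + im x ^+ 2.

Lemma sqmod_ge0 x : 0 <= sqmod x.
Proof. by rewrite addr_ge0// sqr_ge0. Qed.

Lemma sqmod_eq0 x : (sqmod x == 0) = (x == 0).
Proof.
rewrite paddr_eq0 ?sqr_ge0// !sqrf_eq0; apply/andP/eqP => [[/eqP h /eqP h']|->].
  by apply: parts_inj; rewrite ?re0 ?im0.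
by rewrite re0 im0 eqxx.
Qed.

Lemma re_mul_conj x : re (x * conj x) = sqmod x.
Proof. by rewrite reM re_conj im_conj mulrN opprK -!expr2. Qed.

(** This is [1/x = conj x / |x|^2]: the parts of an inverse are quotients of real polynomials in the
    parts of [x]. *)
Lemma inv_parts (x : K) :
  re x^-1 = re x / sqmod x /\ im x^-1 = - (im x / sqmod x).
Proof.
have [->|x0] := eqVneq x 0; first by rewrite invr0 re0 im0 !mul0r oppr0.
have n0 : sqmod x != 0 by rewrite sqmod_eq0.
suff -> : x^-1 = conj x * of_parts (sqmod x)^-1 0.
  rewrite reM imM re_conj im_conj re_of_parts im_of_parts0.
  by rewrite !mulr0 subr0 add0r mulNr.
apply: (mulfI x0); rewrite divff// mulrA; apply: parts_inj.
  by rewrite reM re_mul_conj im_of_parts0 mulr0 subr0 re_of_parts divff// re1.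
rewrite imM im_of_parts0 mulr0 add0r re_of_parts imM re_conj im_conj.
by rewrite mulrN mulrC (mulrC (re x)) addNr mulr0 im1.
Qed.

End GroundField.

(** * Orthogonal projections *)

Section Projections.
Context {R : realType} (s : ground).
Local Notation K := (ground_field R s).

Definition adj m n (A : 'M[K]_(m, n)) : 'M[K]_(n, m) :=
  (map_mx (@conjugate R s) A)^T.

Lemma adjK m n : cancel (@adj m n) (@adj n m).
Proof. by move=> A; apply/matrixP => i j; rewrite !mxE conjK. Qed.

Lemma adjM m n p (A : 'M[K]_(m, n)) (B : 'M[K]_(n, p)) :
  adj (A *m B) = adj B *m adj A.
Proof. by rewrite /adj map_mxM trmx_mul. Qed.

Lemma adjD m n (A B : 'M[K]_(m, n)) : adj (A + B) = adj A + adj B.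
Proof. by rewrite /adj map_mxD linearD. Qed.

Lemma adjB m n (A B : 'M[K]_(m, n)) : adj (A - B) = adj A - adj B.
Proof. by rewrite /adj map_mxB linearB. Qed.

Lemma adj1 n : adj (1%:M : 'M[K]_n) = 1%:M.
Proof. by rewrite /adj map_mx1 trmx1. Qed.

Lemma adj_invmx n (A : 'M[K]_n) : adj (invmx A) = invmx (adj A).
Proof. by rewrite /adj map_invmx trmx_inv. Qed.

Lemma mxrank_adj m n (A : 'M[K]_(m, n)) : \rank (adj A) = \rank A.
Proof. by rewrite /adj mxrank_tr mxrank_map. Qed.

Lemma re_sum I (r : seq I) (F : I -> K) :
  repart (\sum_(i <- r) F i) = \sum_(i <- r) repart (F i).
Proof. by elim/big_rec2: _ => [|i y z _ <-]; [exact: re0 | rewrite reD]. Qed.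

Lemma re_row_mul_adj n (v : 'rV[K]_n) :
  repart ((v *m adj v) ord0 ord0) = \sum_i sqmod (v ord0 i).
Proof.
by rewrite mxE re_sum; apply: eq_bigr => i _; rewrite !mxE re_mul_conj.
Qed.

Lemma sum_sqmod_eq0 n (v : 'rV[K]_n) : \sum_i sqmod (v ord0 i) = 0 -> v = 0.
Proof.
move=> /eqP; rewrite psumr_eq0 => [/allP h|i _]; last exact: sqmod_ge0.
apply/rowP => i; rewrite mxE; apply/eqP; rewrite -sqmod_eq0.
by apply: h; rewrite mem_index_enum.
Qed.

Definition is_proj n (P : 'M[K]_n) : Prop := P *m P = P /\ adj P = P.

Lemma is_proj1 n : is_proj (1%:M : 'M[K]_n).
Proof. by split; [rewrite mulmx1|exact: adj1]. Qed.

(** When [e *m u = u], the term [u *m adj u] has rank at most that of [e]; adding [1%:M - e] fills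
    the orthogonal complement, so that one global inverse replaces inverses in local frames. *)
Definition gram N n (e : 'M[K]_N) (u : 'M[K]_(N, n)) : 'M[K]_N :=
  u *m adj u + (1%:M - e).

(* The orthogonal projection onto the row space of [u], when [e] is the
   orthogonal projection onto the space of coefficients and [e *m u = u]. *)
Definition row_proj N n (e : 'M[K]_N) (u : 'M[K]_(N, n)) : 'M[K]_n :=
  adj u *m invmx (gram e u) *m u.

(** A row [v] killed by the Gram matrix satisfies [|v u|^2 + |v (1 - e)|^2 = 0], so it lies in the
    image of [e] and in the kernel of [u]; equality of ranks makes [u] injective on the image of
    [e]. *)
Lemma gram_unit N n (e : 'M[K]_N) (u : 'M[K]_(N, n)) :
  is_proj e -> e *m u = u -> \rank u = \rank e -> \det (gram e u) != 0.
Proof.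
move=> [ee ae] eu ru; rewrite -unitfE -unitmxE -row_free_unit.
rewrite -kermx_eq0; apply/rowV0P => v.
move=> /sub_kermxP vM.
have : repart ((v *m gram e u *m adj v) ord0 ord0) = 0.
  by rewrite vM mul0mx mxE re0.
have ef : (1%:M - e) = (1%:M - e) *m adj (1%:M - e).
  by rewrite adjB adj1 ae mulmxBr mulmx1 mulmxBl ee mul1mx subrr subr0.
rewrite /gram mulmxDr mulmxDl ef !mulmxA -(mulmxA _ (adj u)) -adjM.
rewrite -(mulmxA _ (adj (1%:M - e))) -adjM mxE reD !re_row_mul_adj => /eqP.
rewrite paddr_eq0 => [/andP[/eqP /sum_sqmod_eq0 vu /eqP /sum_sqmod_eq0 ve]| |];
  try by apply: sumr_ge0 => i _; exact: sqmod_ge0.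
move: ve; rewrite mulmxBr mulmx1 => /eqP; rewrite subr_eq0 => /eqP ve.
have : \rank (e :&: kermx u)%MS = 0%N.
  have := mxrank_mul_ker e u; rewrite eu ru => /eqP.
  by rewrite -[X in _ == X]addn0 eqn_add2l => /eqP.
move=> /eqP; rewrite mxrank_eq0 => /eqP h; apply/eqP; rewrite -submx0 -h.
by rewrite sub_capmx ve submxMl; apply/sub_kermxP; rewrite -ve.
Qed.

Section RowProj.
Variables (N n : nat) (e : 'M[K]_N) (u : 'M[K]_(N, n)).
Hypotheses (pe : is_proj e) (eu : e *m u = u) (du : \det (gram e u) != 0).

Let Mu : gram e u \in unitmx. Proof. by rewrite unitmxE unitfE. Qed.

(** As [1 - e] annihilates [u], it is unchanged by right multiplication by the Gram matrix, hence by
    its inverse. *)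
Let cM : (1%:M - e) *m invmx (gram e u) = 1%:M - e.
Proof.
have [ee ae] := pe.
have {1}-> : 1%:M - e = (1%:M - e) *m gram e u; last by rewrite mulmxK.
rewrite /gram mulmxDr mulmxA mulmxBl mul1mx eu subrr mul0mx add0r.
by rewrite mulmxBr mulmx1 mulmxBl ee mul1mx subrr subr0.
Qed.

Lemma mulmx_row_proj : u *m row_proj e u = u.
Proof.
rewrite /row_proj !mulmxA.
have -> : u *m adj u = gram e u - (1%:M - e) by rewrite /gram addrK.
by rewrite mulmxBl mulmxV// cM mulmxBl mul1mx mulmxBl mul1mx eu subrr subr0.
Qed.

Lemma row_proj_proj : is_proj (row_proj e u).
Proof.
have [ee ae] := pe; split.
  by rewrite {1}/row_proj -!mulmxA mulmx_row_proj /row_proj !mulmxA.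
rewrite /row_proj !adjM adjK adj_invmx mulmxA; congr (_ *m invmx _ *m _).
by rewrite /gram adjD adjM adjK adjB adj1 ae.
Qed.

Lemma row_proj_eqmx : (row_proj e u :=: u)%MS.
Proof.
apply/eqmxP; rewrite {1}/row_proj submxMl.
by rewrite -{1}mulmx_row_proj submxMl.
Qed.

(** Converse of [gram_unit]: since [e *m gram e u = u *m adj u], an invertible Gram matrix factors
    [e] through [u]. *)
Lemma rank_gram_unit : \rank u = \rank e.
Proof.
apply/eqP; rewrite eqn_leq; apply/andP; split.
  by rewrite -eu mxrankM_maxl.
have {1}-> : e = u *m (adj u *m invmx (gram e u)); last exact: mxrankM_maxl.
have [ee ae] := pe; rewrite mulmxA -[LHS](mulmxK Mu); congr (_ *m _).
rewrite /gram mulmxDr mulmxA eu mulmxBr mulmx1 ee subrr addr0 //.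
Qed.

End RowProj.

(** Equal row spaces give [P Q = P] and [Q P = Q]; the adjoint of the first is [Q P = P]. *)
Lemma proj_unique n (P Q : 'M[K]_n) : is_proj P -> is_proj Q ->
  (P :=: Q)%MS -> P = Q.
Proof.
move=> [PP aP] [QQ aQ] eqPQ.
have /submxP[D PD] : (P <= Q)%MS by rewrite eqPQ.
have /submxP[D' QD] : (Q <= P)%MS by rewrite eqPQ.
have PQ : P *m Q = P by rewrite PD -mulmxA QQ.
have QP : Q *m P = Q by rewrite QD -mulmxA PP.
by rewrite -aP -PQ adjM aP aQ.
Qed.

(** An inclusion of row spaces suffices, the ranks being equal. This identifies the deformed family
    with the given one at time 0 and over the sphere. *)
Lemma row_proj_eq N n (e : 'M[K]_N) (u : 'M[K]_(N, n)) (P : 'M[K]_n) :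
  is_proj e -> e *m u = u -> \det (gram e u) != 0 ->
  is_proj P -> u *m P = u -> \rank P = \rank e -> row_proj e u = P.
Proof.
move=> pe eu du pP uP rP; apply: proj_unique => //; first exact: row_proj_proj.
apply: (eqmx_trans (row_proj_eqmx pe eu du)); apply/eqmxP.
rewrite -(geq_leqif (mxrank_leqif_eq _)); last by rewrite -uP submxMl.
by rewrite rP (rank_gram_unit pe eu du).
Qed.

(** On the image of [P] the matrix [1 - P + Q] acts as [Q], and it is near the identity when [Q] is
    near [P]: projecting a frame onto a nearby subspace loses no rank. *)
Lemma projB_unit_rank N n (u : 'M[K]_(N, n)) (P Q : 'M[K]_n) :
  u *m P = u -> \det (1%:M - P + Q) != 0 -> \rank (u *m Q) = \rank u.
Proof.
move=> uP dPQ; have -> : u *m Q = u *m (1%:M - P + Q).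
  by rewrite mulmxDr mulmxBr mulmx1 uP subrr add0r.
by rewrite mxrankMfree// row_free_unit unitmxE unitfE.
Qed.

End Projections.

(** * Continuity of matrix operations *)

Section GroundTopology.
Context {R : realType} (s : ground).
Local Notation K := (ground_field R s).

Lemma repart_lt (e : R) (z : K) : 0 < e -> `|z| < of_parts s e 0 ->
  `|repart z| < e /\ `|impart z| < e.
Proof.
rewrite /of_parts; move: z; case: s => /= [z e0 ze|[a b] e0]; first by rewrite normr0.
rewrite complex.normc_def complex.ltcE /= eqxx /= => h.
suff H x y : Num.sqrt (x ^+ 2 + y ^+ 2) < e -> `|x| < e.
  by split; [apply: H h | apply: (H b a); rewrite addrC].
apply: le_lt_trans; rewrite -sqrtr_sqr ler_wsqrtr// lerDl sqr_ge0//.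
Qed.

Lemma of_parts_gt0 (e : R) : 0 < e -> 0 < of_parts s e 0.
Proof. by rewrite /of_parts; case: s => //= e0; rewrite complex.ltcE/= eqxx. Qed.

(** A positive complex number has zero imaginary part, so a real bound is available; in that case
    half of it works, as [2 (e/2)^2 < e^2]. *)
Lemma ground_gt0 (e : K) : 0 < e -> exists2 d : R, 0 < d &
  forall z, `|repart z| < d -> `|impart z| < d -> `|z| < e.
Proof.
rewrite /repart /impart; case: s e => /= [e e0|[e e'] ]; first by exists e.
rewrite complex.ltcE /= => /andP[/eqP -> e0].
exists (e / 2) => [|[a b] /= ha hb]; first by rewrite divr_gt0.
rewrite complex.normc_def complex.ltcE /= eqxx /=.
rewrite -[X in _ < X](@ger0_norm _ e) ?ltW// -sqrtr_sqr ltr_sqrt ?exprn_gt0//.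
have l2 (x : R) : `|x| < e / 2 -> x ^+ 2 < e ^+ 2 / 4.
  move=> h; rewrite -real_normK ?num_real//.
  have -> : e ^+ 2 / 4 = (e / 2) ^+ 2 by field.
  by rewrite ltr_pXn2r// ?nnegrE ?divr_ge0// ltW.
have := l2 _ ha; have := l2 _ hb; have : 0 < e ^+ 2 by rewrite exprn_gt0.
lra.
Qed.

Section Cvg.
Context {T : Type} {F : set_system T} {FF : Filter F}.

Lemma cvg_re (f : T -> K) l : f @ F --> l -> repart (f x) @[x --> F] --> repart l.
Proof.
move=> /cvgrPdist_lt fl; apply/cvgrPdist_lt => e e0.
apply: filterS (fl _ (of_parts_gt0 e0)) => x /(repart_lt e0)[+ _].
by rewrite reD reN.
Qed.

Lemma cvg_im (f : T -> K) l : f @ F --> l -> impart (f x) @[x --> F] --> impart l.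
Proof.
move=> /cvgrPdist_lt fl; apply/cvgrPdist_lt => e e0.
apply: filterS (fl _ (of_parts_gt0 e0)) => x /(repart_lt e0)[_].
by rewrite imD imN.
Qed.

Lemma cvg_parts (f : T -> K) l : repart (f x) @[x --> F] --> repart l ->
  impart (f x) @[x --> F] --> impart l -> f @ F --> l.
Proof.
move=> /cvgrPdist_lt fr /cvgrPdist_lt fi; apply/cvgrPdist_lt => e.
move=> /ground_gt0[d d0 H]; apply: filterS2 (fr _ d0) (fi _ d0) => x.
by rewrite -imN -imD -reN -reD; exact: H.
Qed.

Lemma cvg_conj (f : T -> K) l : f @ F --> l ->
  conjugate (f x) @[x --> F] --> conjugate l.
Proof.
move=> fl; apply: cvg_parts.
  by under eq_fun do rewrite re_conj; rewrite re_conj; exact: cvg_re.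
under eq_fun do rewrite im_conj; rewrite im_conj.
by apply: (@cvgN _ R^o); exact: cvg_im.
Qed.

Lemma cvg_of_real (f : T -> R) l : f @ F --> l ->
  of_parts s (f x) 0 @[x --> F] --> of_parts s l 0.
Proof.
move=> fl; apply: cvg_parts.
  by under eq_fun do rewrite re_of_parts; rewrite re_of_parts.
by under eq_fun do rewrite im_of_parts0; rewrite im_of_parts0; exact: cvg_cst.
Qed.

Lemma cvg_mx m n (f : T -> 'M[K]_(m, n)) (l : 'M[K]_(m, n)) :
  (forall i j, f x i j @[x --> F] --> l i j) -> f @ F --> l.
Proof.
move=> fl A [P Pl PA]; rewrite nbhs_simpl /=.
have : \forall x \near F, forall ij : 'I_m * 'I_n, P ij.1 ij.2 (f x ij.1 ij.2).
  by apply: filter_forall => -[i j]; exact: fl (Pl i j).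
by apply: filterS => x h; apply: PA => i j; exact: (h (i, j)).
Qed.

Lemma cvg_entry m n (f : T -> 'M[K]_(m, n)) (l : 'M[K]_(m, n)) i j :
  f @ F --> l -> f x i j @[x --> F] --> l i j.
Proof.
move=> fl; apply: (cvg_comp f (fun M : 'M[K]_(m, n) => M i j) fl).
exact: coord_continuous.
Qed.

Lemma cvg_sum I (r : seq I) (f : I -> T -> K) (l : I -> K) :
  (forall i, f i @ F --> l i) ->
  (\sum_(i <- r) f i x) @[x --> F] --> \sum_(i <- r) l i.
Proof.
move=> fl; elim: r => [|i r ih].
  by under eq_fun do rewrite big_nil; rewrite big_nil; exact: cvg_cst.
under eq_fun do rewrite big_cons; rewrite big_cons.
by apply: (@cvgD _ K^o); [exact: fl|exact: ih].
Qed.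

Lemma cvg_prod I (r : seq I) (f : I -> T -> K) (l : I -> K) :
  (forall i, f i @ F --> l i) ->
  (\prod_(i <- r) f i x) @[x --> F] --> \prod_(i <- r) l i.
Proof.
move=> fl; elim: r => [|i r ih].
  by under eq_fun do rewrite big_nil; rewrite big_nil; exact: cvg_cst.
under eq_fun do rewrite big_cons; rewrite big_cons.
by apply: cvgM; [exact: fl|exact: ih].
Qed.

Lemma cvg_mulmx m n p (f : T -> 'M[K]_(m, n)) (g : T -> 'M[K]_(n, p))
    (a : 'M[K]_(m, n)) (b : 'M[K]_(n, p)) :
  f @ F --> a -> g @ F --> b -> f x *m g x @[x --> F] --> a *m b.
Proof.
move=> fa gb; apply: cvg_mx => i j; under eq_fun do rewrite mxE; rewrite mxE.
by apply: cvg_sum => k; apply: cvgM; exact: cvg_entry.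
Qed.

Lemma cvg_det n (f : T -> 'M[K]_n) (a : 'M[K]_n) :
  f @ F --> a -> \det (f x) @[x --> F] --> \det a.
Proof.
move=> fa; rewrite /determinant; apply: cvg_sum => p.
apply: cvgM; first exact: cvg_cst.
by apply: cvg_prod => i; exact: cvg_entry.
Qed.

Lemma cvg_adjugate n (f : T -> 'M[K]_n) (a : 'M[K]_n) :
  f @ F --> a -> \adj (f x) @[x --> F] --> \adj a.
Proof.
move=> fa; apply: cvg_mx => i j; under eq_fun do rewrite mxE; rewrite mxE.
apply: cvgM; first exact: cvg_cst.
apply: cvg_det; apply: cvg_mx => i' j'.
by under eq_fun do rewrite !mxE; rewrite !mxE; exact: cvg_entry.
Qed.

Lemma cvg_adj m n (f : T -> 'M[K]_(m, n)) (a : 'M[K]_(m, n)) :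
  f @ F --> a -> adj (f x) @[x --> F] --> adj a.
Proof.
move=> fa; apply: cvg_mx => i j; under eq_fun do rewrite !mxE; rewrite !mxE.
by apply: cvg_conj; exact: cvg_entry.
Qed.

Lemma cvg_gram N n (e : T -> 'M[K]_N) (u : T -> 'M[K]_(N, n))
    (a : 'M[K]_N) (b : 'M[K]_(N, n)) :
  e @ F --> a -> u @ F --> b -> gram (e x) (u x) @[x --> F] --> gram a b.
Proof.
move=> ea ub; apply: cvgD; first by apply: cvg_mulmx => //; exact: cvg_adj.
by apply: cvgB => //; exact: cvg_cst.
Qed.

Lemma cvg_adjugate_div n (f : T -> 'M[K]_n) (a : 'M[K]_n) : \det a != 0 ->
  f @ F --> a ->
  (\det (f x))^-1 *: \adj (f x) @[x --> F] --> (\det a)^-1 *: \adj a.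
Proof.
move=> da fa; apply: cvgZ; last exact: cvg_adjugate.
by apply: cvgV => //; exact: cvg_det.
Qed.

End Cvg.

(** [invmx] is defined by cases and leaves singular matrices unchanged; Cramer's formula makes its
    continuity and rationality on invertible matrices visible. *)
Lemma invmxE n (A : 'M[K]_n) : \det A != 0 -> invmx A = (\det A)^-1 *: \adj A.
Proof. by move=> dA; rewrite /invmx unitmxE unitfE dA. Qed.

Lemma continuous_row_proj (T : topologicalType) N n
    (e : T -> 'M[K]_N) (u : T -> 'M[K]_(N, n)) :
  continuous e -> continuous u -> (forall x, \det (gram (e x) (u x)) != 0) ->
  continuous (fun x => row_proj (e x) (u x)).
Proof.
move=> ce cu du x; apply: cvg_mulmx; last exact: cu.
apply: cvg_mulmx; first by apply: cvg_adj; exact: cu.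
under eq_fun do rewrite (invmxE (du _)); rewrite (invmxE (du _)).
by apply: cvg_adjugate_div => //; apply: cvg_gram; [exact: ce|exact: cu].
Qed.

End GroundTopology.

(** * Regular functions *)

Section Rational.
Context {R : realType}.

Section Closure.
Context {T : Type} {N : nat} (c : T -> 'rV[R]_N) (W : set T).

Lemma rational_ext (f g : T -> R) : (forall x, W x -> f x = g x) ->
  rational_on c W f -> rational_on c W g.
Proof.
by move=> fg [p [q H]]; exists p, q => x Wx; have [? <-] := H x Wx; rewrite fg.
Qed.

Lemma rational_cst (a : R) : rational_on c W (fun=> a).
Proof.
exists (mpoly.mpolyC _ a), (mpoly.mpolyC _ 1) => x _.
by rewrite /peval !mpoly.mevalC oner_eq0 divr1.
Qed.

Lemma rational_coord i : rational_on c W (fun x => c x ord0 i).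
Proof.
exists (mpoly.mpolyX _ (mpoly.mnm1 i)), (mpoly.mpolyC _ 1) => x _.
by rewrite /peval mpoly.mevalC mpoly.mevalXU oner_eq0 divr1.
Qed.

Lemma rationalD (f g : T -> R) : rational_on c W f -> rational_on c W g ->
  rational_on c W (fun x => f x + g x).
Proof.
move=> [p [q H]] [p' [q' H']]; exists (p * q' + p' * q), (q * q') => x Wx.
have [q0 ->] := H x Wx; have [q0' ->] := H' x Wx.
rewrite /peval !rmorphD !rmorphM /= -!/(peval _ _) mulf_neq0//; split=> //.
by rewrite addf_div.
Qed.

Lemma rationalM (f g : T -> R) : rational_on c W f -> rational_on c W g ->
  rational_on c W (fun x => f x * g x).
Proof.
move=> [p [q H]] [p' [q' H']]; exists (p * p'), (q * q') => x Wx.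
have [q0 ->] := H x Wx; have [q0' ->] := H' x Wx.
by rewrite /peval !rmorphM /= -!/(peval _ _) mulf_neq0//; rewrite mulf_div.
Qed.

Lemma rationalN (f : T -> R) : rational_on c W f ->
  rational_on c W (fun x => - f x).
Proof.
move=> /(rationalM (rational_cst (-1))); apply: rational_ext => x _.
by rewrite mulN1r.
Qed.

Lemma rationalV (f : T -> R) : (forall x, W x -> f x != 0) ->
  rational_on c W f -> rational_on c W (fun x => (f x)^-1).
Proof.
move=> f0 [p [q H]]; exists q, p => x Wx; have [q0 fE] := H x Wx.
split; last by rewrite fE invf_div.
by apply: contraNneq (f0 x Wx) => p0; rewrite fE p0 mul0r.
Qed.

Lemma rationalX (f : T -> R) n : rational_on c W f ->
  rational_on c W (fun x => f x ^+ n).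
Proof.
move=> rf; elim: n => [|n]; first exact: rational_cst.
by move=> /(rationalM rf); apply: rational_ext => x _; rewrite exprS.
Qed.

Lemma rational_prod I (r : seq I) (f : I -> T -> R) :
  (forall i, rational_on c W (f i)) ->
  rational_on c W (fun x => \prod_(i <- r) f i x).
Proof.
move=> rf; elim: r => [|i r].
  by apply: rational_ext (rational_cst 1) => x _; rewrite big_nil.
by move=> /(rationalM (rf i)); apply: rational_ext => x _; rewrite big_cons.
Qed.

Lemma rational_peval (n : nat) (p : mpoly.mpoly n R) (f : 'I_n -> T -> R) :
  (forall i, rational_on c W (f i)) ->
  rational_on c W (fun x => mpoly.meval (fun i => f i x) p).
Proof.
move=> rf; elim/mpoly.mpolyind: p => [|a m p _ _ rp].
  by apply: rational_ext (rational_cst 0) => x _; rewrite mpoly.meval0.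
have := rationalM (rational_cst a)
  (rational_prod (index_enum 'I_n) (fun i => rationalX (m i) (rf i))).
move=> /rationalD /(_ rp); apply: rational_ext => x _.
by rewrite mpoly.mevalD mpoly.mevalZ mpoly.mevalX.
Qed.

End Closure.

Lemma rational_comp (T T' : Type) (N N' : nat) (c : T -> 'rV[R]_N)
    (c' : T' -> 'rV[R]_N') (W : set T) (W' : set T') (h : T -> T') (f : T' -> R) :
  (forall i, rational_on c W (fun x => c' (h x) ord0 i)) ->
  (forall x, W x -> W' (h x)) ->
  rational_on c' W' f -> rational_on c W (f \o h).
Proof.
move=> rh WW' [p [q H]].
have P0 x : W x -> peval q (c' (h x)) != 0 by move=> /WW' /H[].
apply: rational_ext (rationalM (rational_peval p rh)
  (rationalV P0 (rational_peval q rh))) => x Wx.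
by rewrite /= (H _ (WW' _ Wx)).2.
Qed.

Lemma rational_sub (T : Type) (N : nat) (c : T -> 'rV[R]_N) (W W' : set T)
    (f : T -> R) : W' `<=` W -> rational_on c W f -> rational_on c W' f.
Proof. by move=> WW' [p [q H]]; exists p, q => x /WW'; exact: H. Qed.

Lemma cvg_peval (N : nat) (p : mpoly.mpoly N R) T (F : set_system T)
    {FF : Filter F} (f : T -> 'rV[R]_N) (l : 'rV[R]_N) :
  (forall i, f x ord0 i @[x --> F] --> l ord0 i) ->
  peval p (f x) @[x --> F] --> peval p l.
Proof.
move=> fl; elim/mpoly.mpolyind: p => [|a m p _ _ cp].
  under eq_fun do rewrite /peval mpoly.meval0.
  by rewrite /peval mpoly.meval0; exact: cvg_cst.
have E y : peval (a *: mpoly.mpolyX _ m + p) y =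
    a * \prod_(i < N) y ord0 i ^+ m i + peval p y.
  by rewrite /peval mpoly.mevalD mpoly.mevalZ mpoly.mevalX.
under eq_fun do rewrite E; rewrite E.
apply: (@cvgD _ R^o) => //; apply: cvgM; first exact: cvg_cst.
apply: (@cvg_prod _ RealNumbers) => i; elim: (m i) => [|k ih].
  exact: cvg_cst.
by under eq_fun do rewrite exprS; rewrite exprS; apply: cvgM.
Qed.

Lemma continuous_peval (N : nat) (p : mpoly.mpoly N R) : continuous (peval p).
Proof.
move=> x; apply: (@cvg_peval _ _ _ (nbhs x) (nbhs_filter (x : 'rV[R]_N)) id).
by move=> i; exact: coord_continuous.
Qed.

Lemma continuous_rational (T : topologicalType) (N : nat) (c : T -> 'rV[R]_N)
  (f : T -> R) : continuous c -> rational_on c setT f -> continuous f.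
Proof.
move=> cc [p [q H]].
have -> : f = fun x => peval p (c x) / peval q (c x).
  by apply/funext => x; rewrite (H x I).2.
move=> x; apply: cvgM.
  by apply: continuous_comp; [exact: cc|exact: continuous_peval].
apply: cvgV; first by have [] := H x I.
by apply: continuous_comp; [exact: cc|exact: continuous_peval].
Qed.

End Rational.

Section RationalGround.
Context {R : realType} (s : ground) {T : Type} {N : nat} (c : T -> 'rV[R]_N).
Variable W : set T.
Local Notation K := (ground_field R s).

Definition krational (f : T -> K) : Prop :=
  rational_on c W (fun x => repart (f x)) /\
  rational_on c W (fun x => impart (f x)).

Lemma krational_ext (f g : T -> K) : (forall x, W x -> f x = g x) ->
  krational f -> krational g.
Proof.
by move=> fg [rf rf']; split; [apply: rational_ext rf | apply: rational_ext rf'];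
  move=> x /fg ->.
Qed.

Lemma krational_cst (a : K) : krational (fun=> a).
Proof. by split; exact: rational_cst. Qed.

Lemma krationalD (f g : T -> K) : krational f -> krational g ->
  krational (fun x => f x + g x).
Proof.
move=> [rf rf'] [rg rg']; split.
  by under eq_fun do rewrite reD; exact: rationalD.
by under eq_fun do rewrite imD; exact: rationalD.
Qed.

Lemma krationalM (f g : T -> K) : krational f -> krational g ->
  krational (fun x => f x * g x).
Proof.
move=> [rf rf'] [rg rg']; split.
  under eq_fun do rewrite reM.
  by apply: rationalD; [|apply: rationalN]; exact: rationalM.
by under eq_fun do rewrite imM; apply: rationalD; exact: rationalM.
Qed.

Lemma krational_conj (f : T -> K) : krational f ->
  krational (fun x => conjugate (f x)).
Proof.
move=> [rf rf']; split; first by under eq_fun do rewrite re_conj.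
by under eq_fun do rewrite im_conj; exact: rationalN.
Qed.

Lemma krationalV (f : T -> K) : (forall x, W x -> f x != 0) -> krational f ->
  krational (fun x => (f x)^-1).
Proof.
move=> f0 [rf rf'].
have rs : rational_on c W (fun x => (sqmod (f x))^-1).
  apply: rationalV => [x /f0|]; first by rewrite sqmod_eq0.
  by apply: rationalD; exact: rationalX.
split.
  by under eq_fun do rewrite (inv_parts _).1; exact: rationalM.
by under eq_fun do rewrite (inv_parts _).2; apply: rationalN; exact: rationalM.
Qed.

Lemma krational_sum I (r : seq I) (f : I -> T -> K) :
  (forall i, krational (f i)) -> krational (fun x => \sum_(i <- r) f i x).
Proof.
move=> rf; elim: r => [|i r].
  by apply: krational_ext (krational_cst 0) => x _; rewrite big_nil.
by move=> /(krationalD (rf i)); apply: krational_ext => x _; rewrite big_cons.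
Qed.

Lemma krational_prod I (r : seq I) (f : I -> T -> K) :
  (forall i, krational (f i)) -> krational (fun x => \prod_(i <- r) f i x).
Proof.
move=> rf; elim: r => [|i r].
  by apply: krational_ext (krational_cst 1) => x _; rewrite big_nil.
by move=> /(krationalM (rf i)); apply: krational_ext => x _; rewrite big_cons.
Qed.

Definition mrational m n (f : T -> 'M[K]_(m, n)) : Prop :=
  forall i j, krational (fun x => f x i j).

Lemma mrational_ext m n (f g : T -> 'M[K]_(m, n)) :
  (forall x, W x -> f x = g x) -> mrational f -> mrational g.
Proof. by move=> fg rf i j; apply: krational_ext (rf i j) => x /fg ->. Qed.

Lemma mrational_cst m n (a : 'M[K]_(m, n)) : mrational (fun=> a).
Proof. by move=> i j; exact: krational_cst. Qed.

Lemma mrationalD m n (f g : T -> 'M[K]_(m, n)) : mrational f -> mrational g ->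
  mrational (fun x => f x + g x).
Proof.
move=> rf rg i j; under eq_fun do rewrite mxE.
by apply: krationalD; [exact: rf|exact: rg].
Qed.

Lemma mrationalZ m n (a : K) (f : T -> 'M[K]_(m, n)) : mrational f ->
  mrational (fun x => a *: f x).
Proof.
move=> rf i j; under eq_fun do rewrite mxE.
by apply: krationalM; [exact: krational_cst|exact: rf].
Qed.

Lemma mrational_mulmx m n p (f : T -> 'M[K]_(m, n)) (g : T -> 'M[K]_(n, p)) :
  mrational f -> mrational g -> mrational (fun x => f x *m g x).
Proof.
move=> rf rg i j; under eq_fun do rewrite mxE.
by apply: krational_sum => k; apply: krationalM; [exact: rf|exact: rg].
Qed.

Lemma krational_det n (f : T -> 'M[K]_n) : mrational f ->
  krational (fun x => \det (f x)).
Proof.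
move=> rf; rewrite /determinant; apply: krational_sum => p.
apply: krationalM; first exact: krational_cst.
by apply: krational_prod => i; exact: rf.
Qed.

Lemma mrational_invmx n (f : T -> 'M[K]_n) :
  (forall x, W x -> \det (f x) != 0) -> mrational f ->
  mrational (fun x => invmx (f x)).
Proof.
move=> df rf.
suff : mrational (fun x => (\det (f x))^-1 *: \adj (f x)).
  by apply: mrational_ext => x /df dfx; rewrite invmxE.
move=> i j; under eq_fun do rewrite !mxE.
apply: krationalM; first by apply: krationalV => //; exact: krational_det.
apply: krationalM; first exact: krational_cst.
apply: krational_det => k l; under eq_fun do rewrite !mxE.
exact: rf.
Qed.

Lemma mrational_adj m n (f : T -> 'M[K]_(m, n)) : mrational f ->
  mrational (fun x => adj (f x)).
Proof.
move=> rf i j; under eq_fun do rewrite !mxE.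
by apply: krational_conj; exact: rf.
Qed.

Lemma mrational_row_proj p n (e : T -> 'M[K]_p) (u : T -> 'M[K]_(p, n)) :
  (forall x, W x -> \det (gram (e x) (u x)) != 0) ->
  mrational e -> mrational u -> mrational (fun x => row_proj (e x) (u x)).
Proof.
move=> du re ru; apply: mrational_mulmx => //.
apply: mrational_mulmx; first exact: mrational_adj.
apply: mrational_invmx => //; apply: mrationalD.
  by apply: mrational_mulmx => //; exact: mrational_adj.
apply: mrationalD; first exact: mrational_cst.
have := mrationalZ (-1) re; apply: mrational_ext => x _.
by rewrite scaleN1r.
Qed.

End RationalGround.

(** * The Stone-Weierstrass theorem *)

(** The filter [F] consists of the families that contain every large enough set satisfying [P]. Near
    each point of [C], membership in such a set holds eventually along [F], and the near-covering
    form of compactness makes this uniform on [C]. *)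
Lemma compact_induction (Y : topologicalType) (C : set Y)
    (P : set Y -> Prop) : compact C -> P set0 ->
  (forall U V, P U -> P V -> P (U `|` V)) ->
  (forall x, C x -> exists2 U, nbhs x U & P U) ->
  exists2 U, P U & C `<=` U.
Proof.
move=> /compact_near_coveringP cC P0 PU locP.
pose F : set_system (set Y) :=
  [set Q | exists2 U, P U & forall V, P V -> U `<=` V -> Q V].
have FF : Filter F.
  split.
  - by exists set0.
  - move=> Q Q' [U PU' UQ] [V PV VQ]; exists (U `|` V); first exact: PU.
    move=> W PW UVW; split; [apply: UQ => //|apply: VQ => //].
      by move=> y Uy; apply: UVW; left.
    by move=> y Vy; apply: UVW; right.
  - by move=> Q Q' QQ' [U PU' UQ]; exists U => // V PV /(UQ _ PV); exact: QQ'.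
have [] := cC _ F (fun V y => V y) FF.
  move=> x /locP[U xU PU']; exists (U, [set V | P V /\ U `<=` V]) => /=.
    by split => //; exists U.
  by move=> [y V] /= [Uy [_]]; exact.
by move=> U PU' H; exists U => //; exact: H.
Qed.

Section StoneWeierstrass.
Context {R : realType} {Y : topologicalType} (C : set Y).
Variable A : set (Y -> R).
Hypothesis C_compact : compact C.
Hypothesis A_continuous : forall f, A f -> continuous f.
Hypothesis A_cst : forall a : R, A (fun=> a).
Hypothesis AD : forall f g, A f -> A g -> A (fun y => f y + g y).
Hypothesis AM : forall f g, A f -> A g -> A (fun y => f y * g y).
Hypothesis A_separates : forall x y, C x -> C y -> x <> y ->
  exists2 f, A f & f x != f y.

(** The uniform closure of [A] on [C]. Its members need not be continuous, as nothing restricts them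
    outside of [C]. *)
Let A' : set (Y -> R) := [set f | forall e : R, 0 < e ->
  exists2 a, A a & forall y, C y -> `|a y - f y| < e].

Let AA' f : A f -> A' f.
Proof. by move=> Af e e0; exists f => // y _; rewrite subrr normr0. Qed.

Let AZ a f : A f -> A (fun y => a * f y).
Proof. by move=> Af; apply: AM => //; exact: A_cst. Qed.

Let A'D f g : A' f -> A' g -> A' (fun y => f y + g y).
Proof.
move=> Af Ag e e0; have e2 : 0 < e / 2 by rewrite divr_gt0.
have [a Aa fa] := Af _ e2; have [b Ab gb] := Ag _ e2.
exists (fun y => a y + b y) => [|y Cy]; first exact: AD.
rewrite opprD addrACA (le_lt_trans (ler_normD _ _))//.
by rewrite [ltRHS](splitr e) ltrD ?fa ?gb.
Qed.

Let A'Z a f : A' f -> A' (fun y => a * f y).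
Proof.
move=> Af e e0; have h : 0 < e / (1 + `|a|) by rewrite divr_gt0// ltr_pwDl.
have [b Ab fb] := Af _ h; exists (fun y => a * b y) => [|y Cy]; first exact: AZ.
rewrite -mulrBr normrM; have := fb _ Cy; rewrite ltr_pdivlMr ?ltr_pwDl//.
by move=> /(le_lt_trans _); apply; rewrite mulrC ler_wpM2l// lerDr.
Qed.

Let A_bounded a : A a -> exists2 M : R, 0 < M & forall y, C y -> `|a y| <= M.
Proof.
move=> Aa; pose P U := exists2 M : R, 0 < M & forall y, U y -> `|a y| <= M.
have [] := @compact_induction _ _ P C_compact.
- by exists 1.
- move=> U V [M M0 UM] [M' M0' VM]; exists (M + M'); first exact: addr_gt0.
  move=> y [/UM|/VM] /le_trans; apply; by rewrite (lerDl, lerDr) ltW.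
- move=> x Cx; have /cvgrPdist_lt /(_ _ ltr01) H := A_continuous Aa (x := x).
  exists [set y | `|a x - a y| < 1] => //.
  exists (`|a x| + 1) => [|y /= h]; first by rewrite ltr_wpDl.
  have -> : a y = a x - (a x - a y) by rewrite subKr.
  by rewrite (le_trans (ler_normB _ _))// lerD2l ltW.
- by move=> U [M M0 H] CU; exists M => // y /CU; exact: H.
Qed.

Let sqrt_approx (f : Y -> R) : A f -> (forall y, C y -> 0 <= f y <= 1) ->
  A' (fun y => Num.sqrt (f y)).
Proof.
move=> Af f01.
(* Newton-like iteration increasing to the square root; the invariant gives
   the uniform error bound [2 / n]. *)
pose p := fix p n : Y -> R := if n is n'.+1
  then fun y => p n' y + 2^-1 * (f y + -1 * (p n' y * p n' y)) else fun=> 0.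
have Ap n : A (p n).
  elim: n => [|n ih]; first exact: A_cst.
  by apply: AD => //; apply: AZ; apply: AD => //; apply: AZ; exact: AM.
have pE n y : C y -> let r := Num.sqrt (f y) in
    0 <= p n y <= r /\ (r - p n y) * (2 + n%:R * r) <= 2 * r.
  move=> Cy; have /andP[f0 f1] := f01 _ Cy; set r := Num.sqrt (f y) => /=.
  have r0 : 0 <= r by exact: sqrtr_ge0.
  have fr : f y = r * r by rewrite -expr2 sqr_sqrtr.
  have r1 : r <= 1 by rewrite -sqrtr1 ler_wsqrtr.
  elim: n => [|n [/andP[p0 pr] ih]] /=.
    by rewrite lexx r0 mul0r addr0 subr0 mulrC.
  set q := p n y in p0 pr ih *.
  have q1 : q <= 1 by exact: le_trans r1.
  (* One step multiplies the error by [1 - (r + q) / 2 <= 1 - r / 2], and [(1 - r / 2) * (2 + (n +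
     1) * r) <= 2 + n * r] preserves the invariant. *)
  have E : r - (q + 2^-1 * (f y + -1 * (q * q))) =
      (r - q) * (1 - (r + q) / 2) by rewrite fr; field.
  have d0 : 0 <= r - q by rewrite subr_ge0.
  have h0 : 0 <= 1 - (r + q) / 2 by lra.
  split.
    apply/andP; split; first by rewrite fr; nra.
    by rewrite -subr_ge0 E mulr_ge0.
  rewrite E; apply: le_trans ih; rewrite -mulrA ler_wpM2l//.
  have n0 : 0 <= n%:R :> R by [].
  rewrite -[n.+1%:R]natr1; apply: (@le_trans _ _ ((1 - r / 2) * (2 + (n%:R + 1) * r))).
    apply: ler_wpM2r; last by lra.
    by rewrite addr_ge0// mulr_ge0// addr_ge0.
  have : 0 <= (n%:R + 1) * r * r by rewrite !mulr_ge0// addr_ge0.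
  lra.
move=> e e0; pose n := (Num.truncn (2 / e)).+1.
have ne : 2 < n%:R * e.
  by rewrite -ltr_pdivrMr//; exact: truncnS_gt.
exists (p n) => // y Cy; have [/andP[p0 pr] H] := pE n y Cy.
rewrite distrC ger0_norm ?subr_ge0//.
set r := Num.sqrt (f y) in pr H *.
have [r0|r0] := leP r 0; first by lra.
have n0 : 0 < n%:R :> R by [].
rewrite -(ltr_pM2r (_ : 0 < n%:R * r)) ?mulr_gt0//.
have := ltr_pM2l r0 2 (n%:R * e); rewrite ne => h.
have d0 : 0 <= r - p n y by rewrite subr_ge0.
lra.
Qed.

(** Here [|a| = M sqrt (a^2 / M^2)], where a bound [M] of [a] on [C] brings the radicand into
    [[0, 1]]. *)
Let A'_norm f : A' f -> A' (fun y => `|f y|).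
Proof.
move=> Af e e0; have e2 : 0 < e / 2 by rewrite divr_gt0.
have [a Aa fa] := Af _ e2; have [M M0 aM] := A_bounded Aa.
have Ab : A (fun y => M^-1 ^+ 2 * (a y * a y)) by apply: AZ; exact: AM.
have b1 y : C y -> 0 <= M^-1 ^+ 2 * (a y * a y) <= 1.
  move=> /aM ayM; rewrite -expr2 -exprMn sqr_ge0 -[_ ^+ 2]real_normK ?num_real//=.
  by rewrite expr_le1// normrM normfV (gtr0_norm M0) mulrC ler_pdivrMr ?mul1r.
have [b Ab' bE] := A'Z M (sqrt_approx Ab b1) e2.
exists b => // y Cy; have := bE _ Cy.
have -> : Num.sqrt (M^-1 ^+ 2 * (a y * a y)) = M^-1 * `|a y|.
  by rewrite -expr2 -exprMn sqrtr_sqr normrM normfV (gtr0_norm M0).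
rewrite mulVKf ?gt_eqF// => h.
have -> : b y - `|f y| = (b y - `|a y|) + (`|a y| - `|f y|) by rewrite addrA subrK.
rewrite (le_lt_trans (ler_normD _ _))// [ltRHS]splitr ltrD//.
exact: le_lt_trans (ler_dist_dist _ _) (fa _ Cy).
Qed.

Let A'_max f g : A' f -> A' g -> A' (fun y => Num.max (f y) (g y)).
Proof.
move=> Af Ag; have Afg := A'_norm (A'D Af (A'Z (-1) Ag)).
have := A'Z 2^-1 (A'D (A'D Af Ag) Afg).
congr (A' _); apply/funext => y; rewrite mulN1r.
case: (leP (f y) (g y)) => h; first by rewrite ler0_norm ?subr_le0//; field.
by rewrite gtr0_norm ?subr_gt0//; field.
Qed.

Let A'_min f g : A' f -> A' g -> A' (fun y => Num.min (f y) (g y)).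
Proof.
move=> Af Ag; have := A'Z (-1) (A'_max (A'Z (-1) Af) (A'Z (-1) Ag)).
congr (A' _); apply/funext => y; rewrite !mulN1r.
case: (leP (f y) (g y)) => h; first by rewrite max_l ?lerN2// opprK.
by rewrite max_r ?lerN2 ?ltW// opprK.
Qed.

Let interpolation (x y : Y) (a b : R) : C x -> C y -> (x = y -> a = b) ->
  exists f, [/\ A f, f x = a & f y = b].
Proof.
move=> Cx Cy ab; have [/ab <-|xy] := pselect (x = y); first by exists (fun=> a).
have [f Af fxy] := A_separates Cx Cy xy.
have d0 : f y - f x != 0 by rewrite subr_eq0 eq_sym.
exists (fun z => a + (b - a) / (f y - f x) * (f z + - f x)); split.
- by apply: AD => //; apply: AZ; apply: AD.
- by rewrite subrr mulr0 addr0.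
- by rewrite divfK// addrC subrK.
Qed.

Theorem stone_weierstrass (g : Y -> R) (e : R) : continuous g -> 0 < e ->
  exists2 f, A f & forall y, C y -> `|f y - g y| < e.
Proof.
move=> cg e0; have e4 : 0 < e / 4 by rewrite divr_gt0.
(* All interpolants used for a given [x] equal [g x] there, and so does their maximum, while each of
   them takes care of a neighborhood of another point. *)
have lower x : C x -> exists f, [/\ A' f, f x = g x &
    forall y, C y -> g y - e / 4 < f y].
  move=> Cx; pose P U := exists f, [/\ A' f, f x = g x &
    forall y, U y -> g y - e / 4 < f y].
  have [] := @compact_induction _ _ P C_compact.
  - by exists (fun=> g x); split=> //; exact/AA'/A_cst.
  - move=> U V [f [Af fx fU]] [h [Ah hx hV]].
    exists (fun y => Num.max (f y) (h y)); split; first exact: A'_max.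
      by rewrite fx hx maxxx.
    by move=> y [/fU|/hV] H; rewrite lt_max H ?orbT.
  - move=> y Cy; have gxy : x = y -> g x = g y by move=> ->.
    have [f [Af fx fy]] := interpolation Cx Cy gxy.
    have /cvgrPdist_lt /(_ _ e4) H : (f z - g z) @[z --> y] --> f y - g y.
      by apply: (@cvgB _ R^o); [exact: A_continuous|exact: cg].
    exists [set z | `|f y - g y - (f z - g z)| < e / 4] => //.
    exists f; split=> //; first exact: AA'.
    by move=> z /=; rewrite fy subrr sub0r normrN ltr_norml => /andP[+ _]; lra.
  - by move=> U [f [Af fx fU]] CU; exists f; split=> // y /CU; exact: fU.
have : exists2 f, A' f & forall y, C y -> `|f y - g y| < e / 2.
  (* The induction over minima starts from a function above [g - e / 2], which [lower] supplies only
     from a point of [C]. *)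
  have [[x0 Cx0]|C0] := pselect (C !=set0); last first.
    by exists (fun=> 0) => [|y Cy]; [exact/AA'/A_cst|case: C0; exists y].
  pose P U := exists f, [/\ A' f, forall y, C y -> g y - e / 2 < f y &
    forall y, U y -> f y < g y + e / 2].
  have [] := @compact_induction _ _ P C_compact.
  - have [f [Af _ fC]] := lower _ Cx0; exists f; split=> // y /fC; lra.
  - move=> U V [f [Af fC fU]] [h [Ah hC hV]].
    exists (fun y => Num.min (f y) (h y)); split; first exact: A'_min.
      by move=> y Cy; rewrite lt_min fC ?hC.
    by move=> y [/fU|/hV] H; rewrite gt_min H ?orbT.
  - move=> x Cx; have [f [Af fx fC]] := lower _ Cx.
    have e8 : 0 < e / 8 by rewrite divr_gt0.
    (* As [f] may be discontinuous, the neighborhood is obtained from some [a] in [A] within [e / 8]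
       of it; the total loss [e / 4 + e / 8] stays below [e / 2]. *)
    have [a Aa fa] := Af _ e8.
    have /cvgrPdist_lt /(_ _ e8) H : (a z - g z) @[z --> x] --> a x - g x.
      by apply: (@cvgB _ R^o); [exact: A_continuous|exact: cg].
    exists [set z | `|a x - g x - (a z - g z)| < e / 8] => //.
    have ax := fa _ Cx; rewrite fx ltr_norml in ax; have /andP[_ ax'] := ax.
    exists a; split=> [|y Cy|z /=]; first exact: AA'.
      have := fC _ Cy; have := fa _ Cy; rewrite ltr_norml => /andP[+ _]; lra.
    by rewrite ltr_norml => /andP[+ _]; lra.
  - move=> U [f [Af fC fU]] CU; exists f => // y Cy.
    by rewrite ltr_norml; have := fC y Cy; have := fU y (CU y Cy); lra.
move=> [f Af fg]; have e2 : 0 < e / 2 by rewrite divr_gt0.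
have [a Aa af] := Af _ e2; exists a => // y Cy.
rewrite -(subrK (f y) (a y)) -addrA (le_lt_trans (ler_normD _ _))//.
by rewrite [ltRHS]splitr ltrD ?af ?fg.
Qed.

End StoneWeierstrass.

(** * Topological and algebraic bundles *)

Lemma cvg_set_val (T : Type) (F : set_system T) {FF : Filter F}
    (V : topologicalType) (A : set V) (f : T -> A) (l : A) :
  set_val (f z) @[z --> F] --> set_val l -> f @ F --> l.
Proof.
move=> fl U [_ [[W oW <-] /= Wl] WU].
have /fl : nbhs (set_val l) W by exact: open_nbhs_nbhs.
by rewrite !nbhs_simpl /fmap /=; apply: filterS => z Wz; exact: WU.
Qed.

Lemma cvg_pair_at (T : Type) (F : set_system T) {FF : Filter F}
    (U V : topologicalType) (f : T -> U) (g : T -> V) (a : U) (b : V) :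
  f @ F --> a -> g @ F --> b -> (f x, g x) @[x --> F] --> (a, b).
Proof. exact: cvg_pair. Qed.

Lemma continuous_set_val (V : topologicalType) (A : set V) :
  continuous (set_val : A -> V).
Proof. exact: initial_continuous. Qed.

Lemma near_det_neq0 (R : realType) (s : ground) (T : topologicalType) n
    (A : T -> 'M[ground_field R s]_n) (x : T) :
  {for x, continuous A} -> \det (A x) != 0 ->
  \forall y \near x, \det (A y) != 0.
Proof. by move=> cA dx; exact: cvgr_neq0 (cvg_det cA) dx. Qed.

Section ProjectionBundle.
Context {R : realType} (s : ground) {X : topologicalType} (n k : nat).
Local Notation K := (ground_field R s).
Variable P : X -> 'M[K]_n.
Hypotheses (P_continuous : continuous P) (P_proj : forall x, is_proj (P x)).
Hypothesis P_rank : forall x, \rank (P x) = k.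

Lemma row_basis m (A : 'M[K]_(m, n)) : \rank A = k ->
  exists B : 'M[K]_(k, n), row_free B /\ (B :=: A)%MS.
Proof.
move=> rA; have : exists B : 'M[K]_(\rank A, n), row_free B /\ (B :=: A)%MS.
  by exists (row_base A); split; [exact: row_base_free|exact: eq_row_base].
by rewrite rA.
Qed.

Definition image_bundle : set (X * 'rV[K]_n) := [set z | z.2 *m P z.1 = z.2].

Lemma image_bundle_mem x w : image_bundle (x, w *m P x).
Proof. by rewrite /image_bundle /= -mulmxA (P_proj x).1. Qed.

(** Projecting [w] first gives a point for every [w], so that [w] can be kept fixed while [x]
    varies. *)
Definition image_point (x : X) (w : 'rV[K]_n) : image_bundle :=
  exist _ (x, w *m P x) (mem_set (image_bundle_mem x w)).

Lemma image_pointE (z : image_bundle) :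
  z = image_point (set_val z).1 (set_val z).2.
Proof.
apply: val_inj; case: z => -[x v] zz /=; congr pair.
by move/set_mem: zz => /= ->.
Qed.

Lemma image_bundle_sub (z : image_bundle) :
  ((set_val z).2 <= P (set_val z).1)%MS.
Proof.
have -> : (set_val z).2 = (set_val z).2 *m P (set_val z).1.
  exact: (congr1 (fun z : image_bundle => (set_val z).2) (image_pointE z)).
exact: submxMl.
Qed.

(** Chosen independently at each point, with no continuity in [x]: it serves only to give each fiber
    its linear structure and to provide a frame at one point. *)
Definition image_basis (x : X) : 'M[K]_(k, n) :=
  projT1 (cid (row_basis (P_rank x))).

Lemma image_basis_free x : row_free (image_basis x).
Proof. by rewrite /image_basis; case: cid => B []. Qed.

Lemma image_basis_eqmx x : (image_basis x :=: P x)%MS.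
Proof. by rewrite /image_basis; case: cid => B []. Qed.

Lemma mulmx_proj x p (A : 'M[K]_(p, n)) : (A <= P x)%MS -> A *m P x = A.
Proof. by move=> /submxP[D ->]; rewrite -mulmxA (P_proj x).1. Qed.

Lemma image_basis_proj x : image_basis x *m P x = image_basis x.
Proof. by apply: mulmx_proj; rewrite image_basis_eqmx. Qed.

Lemma image_bundle_bij x : set_bij setT
  ((fun z : image_bundle => (set_val z).1) @^-1` [set x])
  (fun v : 'rV[K]_k => image_point x (v *m image_basis x)).
Proof.
split => //.
- move=> v w _ _ /(congr1 (fun z : image_bundle => (set_val z).2)) /=.
  rewrite -!mulmxA image_basis_proj; apply: row_free_inj.
  exact: image_basis_free.
- move=> z /= zx.
  have : ((set_val z).2 <= image_basis x)%MS.
    by rewrite image_basis_eqmx -zx image_bundle_sub.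
  move=> /submxP[D zD]; exists D => //.
  by rewrite -zD -zx -image_pointE.
Qed.

Definition image_family : vfamily K image_bundle X :=
  @VFamily K image_bundle X _ (fun=> 'rV[K]_k : lmodType K) _ image_bundle_bij.

Lemma continuous_image_point (w : 'rV[K]_n) : continuous (image_point^~ w).
Proof.
move=> x; apply: cvg_set_val.
suff : (z, w *m P z) @[z --> x] --> (x, w *m P x) by [].
apply: cvg_pair_at => /=; first exact: cvg_id.
by apply: cvg_mulmx; [exact: cvg_cst|exact: P_continuous].
Qed.

(** Near [x0] the matrix [A x = 1 - P x0 + P x] is invertible and carries the image of [P x0] onto
    that of [P x]. A basis at [x0] thus propagates, and coordinates are recovered by the inverse of
    [A x] followed by a right inverse [C0] of that basis. *)
Lemma image_family_bundle : topological_bundle k image_family.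
Proof.
have cfst : continuous (vproj image_family).
  move=> z; apply: (continuous_comp (f := set_val) (g := fst)).
    exact: continuous_set_val.
  exact: cvg_fst.
split=> // x0.
pose A x := 1%:M - P x0 + P x.
have cA : continuous A.
  by move=> x; apply: cvgD; [exact: cvg_cst|exact: P_continuous].
have /row_freeP[C0 BC0] := image_basis_free x0.
pose phi (z : image_bundle) : X * 'rV[K]_k := ((set_val z).1,
  (set_val z).2 *m ((\det (A (set_val z).1))^-1 *: \adj (A (set_val z).1)) *m C0).
pose psi (z : X * 'rV[K]_k) := image_point z.1 (z.2 *m image_basis x0).
have BA x : image_basis x0 *m P x = image_basis x0 *m A x.
  by rewrite mulmxDr mulmxBr mulmx1 image_basis_proj subrr add0r.
have dA x : \det (A x) != 0 -> A x \in unitmx by rewrite unitmxE unitfE.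
exists [set x | \det (A x) != 0], phi, psi; split.
- split; last by rewrite /= /A subrK det1 oner_eq0.
  rewrite openE => x /= dx; rewrite /interior.
  exact: near_det_neq0 (cA x) dx.
- have phipsi x v : \det (A x) != 0 -> phi (psi (x, v)) = (x, v).
    move=> dx; congr pair => /=.
    rewrite -invmxE// -!mulmxA (mulmxA (P x)) (mulmxA (image_basis x0)).
    rewrite (mulmxA (image_basis x0) (P x)) BA -(mulmxA _ (A x)) mulmxV ?dA//.
    by rewrite mulmx1 BC0 mulmx1.
  split=> [z /= dz|x v /= dx|x /= dx a v w] //.
  + split=> //; rewrite [RHS]image_pointE.
    have : ((set_val z).2 <= image_basis x0 *m P (set_val z).1)%MS.
      apply: submx_trans (image_bundle_sub z) _.
      rewrite -(geq_leqif (mxrank_leqif_sup (submxMl _ _))).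
      by rewrite P_rank BA mxrankMfree ?row_free_unit ?dA// (eqP (image_basis_free x0)).
    move=> /submxP[D zD].
    have zE : z = psi ((set_val z).1, D).
      by rewrite [LHS]image_pointE /psi /=; apply: val_inj => /=;
         rewrite zD -!mulmxA (P_proj _).1.
    by rewrite {1}zE phipsi//= -zE -image_pointE.
  + by split=> //; exact: phipsi.
  + by rewrite /= !mulmxDl -!scalemxAl.
- apply: continuous_in_subspaceT => z; rewrite inE /= => dz.
  have cv1 : (set_val y).1 @[y --> z] --> (set_val z).1 by exact: cfst.
  have cA1 : A (set_val y).1 @[y --> z] --> A (set_val z).1.
    by apply: (cvg_comp _ _ cv1); exact: cA.
  have cv2 : (set_val y).2 @[y --> z] --> (set_val z).2.
    apply: (continuous_comp (f := set_val) (g := snd)).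
      exact: continuous_set_val.
    exact: cvg_snd.
  apply: (cvg_pair_at cv1); apply: cvg_mulmx; last exact: cvg_cst.
  by apply: cvg_mulmx => //; exact: cvg_adjugate_div.
- apply: continuous_subspaceT => z; apply: cvg_set_val.
  suff : (y.1, y.2 *m image_basis x0 *m P y.1) @[y --> z] -->
    (z.1, z.2 *m image_basis x0 *m P z.1) by [].
  apply: cvg_pair_at => /=; first exact: cvg_fst.
  apply: cvg_mulmx; first by apply: cvg_mulmx; [exact: cvg_snd|exact: cvg_cst].
  by apply: continuous_comp; [exact: cvg_fst|exact: P_continuous].
Qed.

End ProjectionBundle.

Lemma linear_mulmx (K : fieldType) (k n : nat) (f : 'rV[K]_k -> 'rV[K]_n) :
  linear f -> forall v, f v = v *m \matrix_i f (delta_mx ord0 i).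
Proof.
move=> lf v.
pose g : {linear 'rV[K]_k -> 'rV[K]_n} := HB.pack f (GRing.isLinear.Build _ _ _ _ f lf).
have -> : f v = v *m lin1_mx g by rewrite mul_rV_lin1.
by congr (_ *m _); apply/matrixP => i j; rewrite !mxE.
Qed.

Section Algebraic.
Context {R : realType} (s : ground).
Local Notation K := (ground_field R s).

Lemma embedded_zopenT (T : choiceType) N (c : T -> 'rV[R]_N) :
  @zopen R (embedded c) setT.
Proof.
exists set0; last by rewrite preimage_set0 setC0.
exists [set mpoly.mpolyC N 1]; apply/seteqP; split=> // x /(_ _ erefl).
by rewrite /peval mpoly.mevalC => /eqP; rewrite oner_eq0.
Qed.

(** Both kinds of half-lines for [q] are positivity sets of functions [a + b * q], hence give
    subbasic open sets. Regularity of these combinations is a hypothesis because an arbitrary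
    [fspace] has no ring axioms for [regular]. *)
Lemma continuous_regular_comp (E F : fspace R) (f : E -> F) (q : F -> R) :
  zopen [set: F] -> algebraic_on setT f ->
  (forall a b : R, regular setT (fun y => a + b * q y)) ->
  continuous (q \o f : euclidean E -> R).
Proof.
move=> FT alg rq x; have [oT rT] := alg _ FT.
have opn a b : open [set y : euclidean E | 0 < a + b * q (f y)].
  have Eb : @euclidean_subbase R E
      ((setT `&` f @^-1` setT) `&` [set y | 0 < a + b * q (f y)]).
    exists (setT `&` f @^-1` setT), ((fun y => a + b * q y) \o f).
    by split => //; exact/rT/rq.
  rewrite (_ : _ `&` _ = [set y | 0 < a + b * q (f y)]) in Eb; last first.
    by apply/seteqP; split=> y //= [].
  exists [set [set y : euclidean E | 0 < a + b * q (f y)]]; last first.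
    by rewrite bigcup_set1.
  by move=> _ ->; exact: finI_from1 Eb.
apply/(@cvgrPdist_lt R R^o _ _ (nbhs_filter (x : euclidean E))) => e e0 /=.
have := filterI (open_nbhs_nbhs (conj (opn (e - q (f x)) 1) _))
  (open_nbhs_nbhs (conj (opn (e + q (f x)) (-1)) _)).
move=> /(_ x); rewrite /= !mul1r !mulN1r addrK subrK => /(_ _ e0 e0).
apply: filterS => y /=; rewrite ltr_norml => -[].
by rewrite mul1r mulN1r; lra.
Qed.

End Algebraic.

Section Coordinates.
Context {R : realType} (s : ground) {m N : nat}.
Local Notation K := (ground_field R s).

Definition times_coord (x : 'rV[R]_m) (v : 'rV[K]_N) : 'rV[R]_(m + (N + N)) :=
  row_mx x (realify v).

Lemma rational_times_coord T p (c : T -> 'rV[R]_p) W (f : T -> 'rV[R]_m)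
    (g : T -> 'rV[K]_N) :
  (forall i, rational_on c W (fun z => f z ord0 i)) -> mrational c W g ->
  forall i, rational_on c W (fun z => times_coord (f z) (g z) ord0 i).
Proof.
move=> rf rg i; case: (split_ordP i) => j ->.
  by apply: rational_ext (rf j) => z _; rewrite row_mxEl.
case: (split_ordP j) => l ->.
  by apply: rational_ext (rg ord0 l).1 => z _; rewrite row_mxEr row_mxEl mxE.
by apply: rational_ext (rg ord0 l).2 => z _; rewrite row_mxEr row_mxEr mxE.
Qed.

Lemma rational_times_base T (f : T -> 'rV[R]_m) (g : T -> 'rV[K]_N) W i :
  rational_on (fun z => times_coord (f z) (g z)) W (fun z => f z ord0 i).
Proof.
by apply: rational_ext (rational_coord _ W (lshift _ i)) => z _; rewrite row_mxEl.
Qed.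

Lemma mrational_times_fiber T (f : T -> 'rV[R]_m) (g : T -> 'rV[K]_N) W :
  mrational (fun z => times_coord (f z) (g z)) W g.
Proof.
move=> i j; rewrite ord1; split.
  apply: rational_ext (rational_coord _ W (rshift m (lshift N j))) => z _.
  by rewrite row_mxEr row_mxEl mxE.
apply: rational_ext (rational_coord _ W (rshift m (rshift N j))) => z _.
by rewrite row_mxEr row_mxEr mxE.
Qed.

End Coordinates.

Lemma algebraic_on_rational (R : realType) (T T' : choiceType) N N'
    (c : T -> 'rV[R]_N) (c' : T' -> 'rV[R]_N') (W : set T) (f : T -> T')
    (g : T' -> R) :
  @algebraic_on R (embedded c) (embedded c') W f ->
  rational_on c' setT g -> rational_on c W (g \o f).
Proof.
move=> /(_ setT (embedded_zopenT c'))[_ H] /H; apply: rational_sub.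
by move=> x Wx.
Qed.

Section Subbundle.
Context {R : realType} (s : ground) {m : nat} {V : set 'rV[R]_m} (k N : nat).
Local Notation K := (ground_field R s).
Variables (S : set (V * 'rV[K]_N)) (xi : vfamily K S V).
Hypothesis xi_sub : prealgebraic_subbundle k xi.

Let xi_bundle : @prealgebraic_bundle R s m V k (subspace_of_times S) xi.
Proof. by case: xi_sub. Qed.

Let xi_proj (z : S) : vproj xi z = (set_val z).1.
Proof. by case: xi_sub. Qed.

Let xi_linear x : linear (fun v : vfiber xi x => (set_val (vpt v)).2).
Proof. by case: xi_sub. Qed.

Let vpt_fst x (v : vfiber xi x) : (set_val (vpt v)).1 = x.
Proof. by rewrite -xi_proj; case: (vpt_bij xi x) => /(_ v I). Qed.

Let fiber_pt x (z : S) : (set_val z).1 = x -> exists v : vfiber xi x, vpt v = z.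
Proof.
move=> zx; case: (vpt_bij xi x) => _ _ /(_ z); rewrite /= xi_proj.
by move=> /(_ zx)[v _ <-]; exists v.
Qed.

(** The rows of [B x] are the images by [psi] of the standard basis. A trivialization only provides
    linearity of [phi], so that of [psi] is deduced by applying [phi]; regularity of [B] is that of
    [psi] along constant sections. *)
Lemma fiber_frame (x0 : V) : exists (U : set V) (B : V -> 'M[K]_(k, N)),
  [/\ @zopen R (base V) U, U x0, mrational (set_val : V -> 'rV[R]_m) U B &
      forall x, U x -> row_free (B x) /\ forall v, S (x, v) <-> (v <= B x)%MS].
Proof.
have [_ _ /(_ x0)[U [phi [psi [[oU Ux0] [phi1 psi1 philin] _ algpsi]]]]] := xi_bundle.
pose L x (c : 'rV[K]_k) := (set_val (psi (x, c))).2.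
have psi_fst x c : U x -> (set_val (psi (x, c))).1 = x.
  by move=> Ux; rewrite -xi_proj; case: (psi1 x c Ux).
have Llin x : U x -> linear (L x).
  move=> Ux a c d.
  have [v vE] := fiber_pt (psi_fst x c Ux); have [w wE] := fiber_pt (psi_fst x d Ux).
  have cE : (phi (vpt v)).2 = c by rewrite vE (psi1 x c Ux).2.
  have dE : (phi (vpt w)).2 = d by rewrite wE (psi1 x d Ux).2.
  have vwE : vpt (a *: v + w) = psi (x, a *: c + d).
    have Uv : U (vproj xi (vpt (a *: v + w))) by rewrite xi_proj vpt_fst.
    have [h1 <-] := phi1 _ Uv; congr psi; apply/pair_eqP.
    rewrite /pair_eq /= h1 xi_proj vpt_fst eqxx /=; apply/eqP.
    by rewrite -cE -dE; exact: (philin x Ux a v w).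
  rewrite /L -vwE -vE -wE; exact: (xi_linear a v w).
pose B x := \matrix_i L x (delta_mx ord0 i).
have LB x c : U x -> L x c = c *m B x by move=> Ux; exact: linear_mulmx (Llin x Ux) c.
exists U, B; split => //.
- move=> i j.
  have [r3 r4] := mrational_times_fiber (fun z : S => set_val (set_val z).1)
     (fun z : S => (set_val z).2) setT ord0 j.
  have r2 : forall l, rational_on (set_val : V -> 'rV[R]_m) U
     (fun x => times_coord (set_val x) (delta_mx ord0 i : 'rV[K]_k) ord0 l).
    by apply: rational_times_coord; [exact: rational_coord|exact: mrational_cst].
  pose c := fun z : V * 'rV[K]_k => times_coord (set_val z.1) z.2.
  pose h := fun x : V => (x, delta_mx ord0 i : 'rV[K]_k).
  have hU x : U x -> (U `*` [set: 'rV[K]_k]) (h x) by [].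
  have r5 := algebraic_on_rational algpsi r3.
  have r6 := algebraic_on_rational algpsi r4.
  split.
    have := @rational_comp _ _ _ _ _ _ c _ _ h _ r2 hU r5.
    by apply: rational_ext => x Ux; rewrite mxE.
  have := @rational_comp _ _ _ _ _ _ c _ _ h _ r2 hU r6.
  by apply: rational_ext => x Ux; rewrite mxE.
- move=> x Ux; split.
    rewrite -kermx_eq0; apply/rowV0P => c /sub_kermxP; rewrite -LB// => Lc.
    have L0 : L x 0 = 0 by rewrite LB// mul0mx.
    have : psi (x, c) = psi (x, 0).
      apply: val_inj; apply/pair_eqP; rewrite /pair_eq /=.
      rewrite -!/(set_val _) !psi_fst// eqxx /=; apply/eqP.
      by rewrite -!/(L _ _) Lc L0.
    move=> /(congr1 phi); rewrite (psi1 x c Ux).2 (psi1 x 0 Ux).2.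
    by move=> [].
  move=> v; split=> [Sv|/submxP[c ->]].
    pose z : S := exist _ (x, v) (mem_set Sv).
    have Uz : U (vproj xi z) by rewrite xi_proj.
    have [h1 h2] := phi1 _ Uz.
    have -> : v = L x (phi z).2; last by rewrite LB// submxMl.
    rewrite /L; have -> : (x, (phi z).2) = phi z.
      by apply/pair_eqP; rewrite /pair_eq /= h1 xi_proj !eqxx.
    by rewrite h2.
  rewrite -LB// /L -{1}(psi_fst x c Ux) -surjective_pairing.
  exact: set_valP.
Qed.

End Subbundle.

Section FiberProjection.
Context {R : realType} (s : ground) {m : nat} {V : set 'rV[R]_m} (k N : nat).
Local Notation K := (ground_field R s).
Variables (S : set (V * 'rV[K]_N)) (xi : vfamily K S V).
Hypothesis xi_sub : prealgebraic_subbundle k xi.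

Lemma row_proj_free (B : 'M[K]_(k, N)) : row_free B ->
  [/\ \det (gram 1%:M B) != 0, is_proj (row_proj 1%:M B),
      (row_proj 1%:M B :=: B)%MS & \rank (row_proj 1%:M B) = k].
Proof.
move=> /eqP Bk; have dB : \det (gram 1%:M B) != 0.
  by apply: gram_unit; [exact: is_proj1|exact: mul1mx|rewrite mxrank1].
have eqB := row_proj_eqmx (is_proj1 s k) (mul1mx B) dB.
split => //; first exact: row_proj_proj (is_proj1 s k) (mul1mx B) dB.
by rewrite eqB.
Qed.

Lemma zero_section x : S (x, 0).
Proof.
have [U [B [_ Ux _ /(_ x Ux)[_ ->]]]] := fiber_frame xi_sub x.
exact: sub0mx.
Qed.

(* The sheaf property of the total space glues regular functions on [V]: pull
   back along the projection, glue, and restrict to the zero section. *)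
Lemma rational_local (q : V -> R) :
  (forall x0, exists U : set V, [/\ @zopen R (base V) U, U x0 &
    rational_on (set_val : V -> 'rV[R]_m) U q]) ->
  rational_on (set_val : V -> 'rV[R]_m) setT q.
Proof.
move=> ql; have [[[_ _ _ _ glue _] algp _] xi_proj _] := xi_sub.
pose c := fun z : S => times_coord (set_val (set_val z).1) (set_val z).2.
have Fr : rational_on c setT (fun z : S => q (set_val z).1).
  apply: (glue setT) => [|z _]; first exact: embedded_zopenT.
  have [U [oU Uz qU]] := ql (set_val z).1.
  have [oW _] := algp U oU.
  exists (setT `&` vproj xi @^-1` U); split => //; first by split; rewrite //= xi_proj.
  apply: (@rational_comp R S V _ _ c (set_val : V -> 'rV[R]_m) _ U
    (fun z : S => (set_val z).1)) => // [i|y [_ /=]]; first exact: rational_times_base.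
  by rewrite xi_proj.
pose z0 x : S := exist _ (x, 0) (mem_set (zero_section x)).
have z0c : forall i, rational_on (set_val : V -> 'rV[R]_m) setT
    (fun x => c (z0 x) ord0 i).
  by apply: rational_times_coord; [exact: rational_coord|exact: mrational_cst].
exact: (@rational_comp _ _ _ _ _ _ c _ setT z0 _ z0c (fun _ _ => I) Fr).
Qed.

(** Local frames do not glue, but the orthogonal projection onto their span is independent of the
    frame. Near [x] it is therefore the rational expression in the frame chosen at [x], and
    [rational_local] applies to its entries. *)
Lemma fiber_projection : exists e : V -> 'M[K]_N,
  mrational (set_val : V -> 'rV[R]_m) setT e /\
  forall x, [/\ is_proj (e x), \rank (e x) = k &
                forall v, S (x, v) <-> (v <= e x)%MS].
Proof.
have /choice[U /choice[B UB]] := fiber_frame xi_sub.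
pose e x := row_proj 1%:M (B x x).
have Bfree x y : U x y -> row_free (B x y) by have [_ _ _ H] := UB x; case/H.
have SB x y : U x y -> forall v, S (y, v) <-> (v <= B x y)%MS.
  by have [_ _ _ H] := UB x; case/H.
have Uxx x : U x x by have [] := UB x.
have eB x y : U x y -> e y = row_proj 1%:M (B x y).
  move=> Uxy; have [_ p1 q1 _] := row_proj_free (Bfree _ _ (Uxx y)).
  have [_ p2 q2 _] := row_proj_free (Bfree _ _ Uxy).
  apply: proj_unique => //; apply/eqmxP; rewrite !(q1, q2).
  by apply/andP; split; apply/rV_subP => v;
    [move/(SB _ _ (Uxx y))/(SB _ _ Uxy)|move/(SB _ _ Uxy)/(SB _ _ (Uxx y))].
exists e; split=> [i j|x]; last first.
  have [_ p1 q1 r1] := row_proj_free (Bfree _ _ (Uxx x)).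
  by split=> // v; rewrite q1; exact: SB.
have re x : mrational (set_val : V -> 'rV[R]_m) (U x) e.
  have : mrational (set_val : V -> 'rV[R]_m) (U x) (fun y => row_proj 1%:M (B x y)).
    apply: mrational_row_proj; last by have [] := UB x.
      by move=> y /(Bfree x)/row_proj_free[].
    exact: mrational_cst.
  by apply: mrational_ext => y Uxy; rewrite (eB _ _ Uxy).
by split; apply: rational_local => x; exists (U x);
  have [oU Ux _ _] := UB x; split => //; have [] := re x i j.
Qed.

End FiberProjection.

Lemma algebraic_model (R : realType) (s : ground) (m n k : nat)
    (X : set 'rV[R]_m) (P : X -> 'M[ground_field R s]_n) :
  (forall (T : topologicalType) (xi : vfamily (ground_field R s) T X),
     topological_bundle k xi ->
     exists (E : fspace R) (eta : vfamily (ground_field R s) (euclidean E) X),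
       algebraic_bundle k eta /\ topologically_isomorphic xi eta) ->
  continuous P -> (forall x, is_proj (P x)) -> (forall x, \rank (P x) = k) ->
  exists N (e : X -> 'M[ground_field R s]_N) (u : X -> 'M[ground_field R s]_(N, n)),
    [/\ mrational (set_val : X -> 'rV[R]_m) setT e, continuous u &
      forall x, [/\ is_proj (e x), \rank (e x) = k, e x *m u x = u x,
                    u x *m P x = u x & \rank (u x) = k]].
Proof.
move=> X_bundles cP pP rP.
have [E [eta [[_ alg] top]]] := X_bundles _ _ (image_family_bundle cP pP rP).
have [N [S [zeta [sub [f [f' [fK fK' fl falg _]]]]]]] := alg.
have [j [j' [jK jK' jl jc _]]] := top.
have [e [re pe]] := fiber_projection sub.
have [_ zeta_proj zeta_lin] := sub.
set K := ground_field R s.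
have h_inj : injective (fun z => f (j z)).
  by move=> z w /(can_inj fK)/(can_inj jK).
have h_fst z : (set_val (f (j z))).1 = (set_val z).1.
  by rewrite -zeta_proj fl.1 jl.1.
pose L x (w : 'rV[K]_n) := (set_val (f (j (image_point pP x w)))).2.
have Llin x : linear (L x).
  have /row_freeP[C BC] := image_basis_free rP x.
  (* The coordinates of [w *m P x] in [image_basis], that is its preimage by [vpt], where linearity
     of bundle maps is expressed. *)
  pose c (w : 'rV[K]_n) : 'rV[K]_k := w *m P x *m C.
  have cE w : image_point pP x w = vpt (v := image_family pP rP) (x := x) (c w).
    apply: val_inj => /=; congr pair.
    have : (w *m P x <= image_basis rP x)%MS by rewrite image_basis_eqmx submxMl.
    move=> /submxP[D DE]; rewrite /c DE -(mulmxA D) BC mulmx1 -mulmxA.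
    by rewrite image_basis_proj.
  have [l1 l1E] := jl.2 x; have [l2 l2E] := fl.2 x.
  move=> a w w'; rewrite /L !cE !l1E !l2E.
  have -> : c (a *: w + w') = a *: c w + c w'.
    by rewrite /c !mulmxDl -!scalemxAl.
  by rewrite !linearP; exact: zeta_lin.
(* [a x] maps the image of [P x] isomorphically onto the fiber of [zeta]; its
   adjoint goes in the opposite direction, with the same rank, so that the
   continuity of the inverse isomorphism is not needed. *)
pose a x := \matrix_i L x (delta_mx ord0 i).
have La x w : L x w = w *m a x by exact: linear_mulmx.
have LP x w : L x (w *m P x) = L x w.
  rewrite /L; congr ((set_val (f (j _))).2); apply: val_inj => /=.
  by rewrite -mulmxA (pP x).1.
have Pa x : P x *m a x = a x.
  by apply/row_matrixP => i; rewrite !rowE mulmxA -!La LP.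
have ae x : a x *m e x = a x.
  have [[ee _] _ Se] := pe x.
  suff /submxP[D aD] : (a x <= e x)%MS by rewrite aD -mulmxA ee.
  apply/rV_subP => v /submxP[D ->]; rewrite -La; apply/Se.
  have := set_valP (f (j (image_point pP x D))).
  by rewrite [X in S X]surjective_pairing h_fst.
have ra x : \rank (a x) = k.
  apply/eqP; rewrite eqn_leq -{1}Pa -{1}(rP x) mxrankM_maxl /=.
  rewrite -[X in (X <= _)%N](_ : \rank (image_basis rP x *m a x) = k) ?mxrankM_maxr//.
  apply/eqP; rewrite -/(row_free _) -kermx_eq0; apply/rowV0P => c /sub_kermxP.
  rewrite mulmxA -La => L0.
  have : image_point pP x (c *m image_basis rP x) = image_point pP x 0.
    apply: h_inj; apply: val_inj.
    rewrite [LHS]surjective_pairing [RHS]surjective_pairing.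
    rewrite -!/(set_val _) !h_fst -!/(L x _) L0.
    by rewrite La mul0mx.
  move=> /(congr1 (fun z : image_bundle P => (set_val z).2)) /=.
  rewrite mul0mx -mulmxA (image_basis_proj pP) => cB.
  by apply: (row_free_inj (image_basis_free rP x)); rewrite cB mul0mx.
(* An entry of [a] is a fiber coordinate on [S], pulled back by the algebraic map [f], hence
   continuous for the Euclidean topology of [E], and then composed with the continuous map [j]. *)
have ca (x : X) : a y @[y --> x] --> a x.
  apply: (@cvg_mx _ _ _ _ (nbhs_filter x)) => i l.
  have cj : continuous (fun y => j (image_point pP y (delta_mx ord0 i))).
    move=> y.
    apply: (continuous_comp (f := fun y => image_point pP y (delta_mx ord0 i))).
      exact: continuous_image_point.
    exact: jc.
  have reg p : rational_on (fun z : S =>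
        times_coord (set_val (set_val z).1) (set_val z).2) setT p -> forall b c : R, rational_on (fun z : S =>
        times_coord (set_val (set_val z).1) (set_val z).2)
      setT (fun y => b + c * p y).
    by move=> rp b c; apply: rationalD; [exact: rational_cst|];
      apply: rationalM => //; exact: rational_cst.
  have [r3 r4] := mrational_times_fiber (fun z : S => set_val (set_val z).1)
     (fun z : S => (set_val z).2) setT ord0 l.
  have c3 := continuous_regular_comp (embedded_zopenT _) falg (reg _ r3).
  have c4 := continuous_regular_comp (embedded_zopenT _) falg (reg _ r4).
  under eq_fun do rewrite mxE; rewrite mxE.
  apply: (@cvg_parts _ _ _ _ (nbhs_filter x)).
    exact: (continuous_comp (cj x) (c3 _)).
  exact: (continuous_comp (cj x) (c4 _)).
exists N, e, (fun x => adj (a x)); split => // [x|x].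
  exact: (@cvg_adj _ _ _ _ (nbhs_filter x) _ _ _ _ (ca x)).
have [px rx _] := pe x.
split => //; rewrite ?mxrank_adj ?ra//.
  by rewrite -{1}px.2 -adjM ae.
by rewrite -{1}(pP x).2 -adjM Pa.
Qed.

(** * Deformation of families of projections *)

Section ContinuousCombinators.
Context {U V W : topologicalType}.

Lemma continuous_comp_fun (f : U -> V) (g : V -> W) :
  continuous g -> continuous f -> continuous (fun x => g (f x)).
Proof. by move=> cg cf x; apply: continuous_comp; [exact: cf|exact: cg]. Qed.

Lemma continuous_pair_fun (f : U -> V) (g : U -> W) :
  continuous f -> continuous g -> continuous (fun x => (f x, g x)).
Proof. by move=> cf cg x; apply: cvg_pair_at; [exact: cf|exact: cg]. Qed.

Lemma continuous_fst : continuous (fst : U * V -> U).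
Proof. by move=> x; exact: cvg_fst. Qed.

Lemma continuous_snd : continuous (snd : U * V -> V).
Proof. by move=> x; exact: cvg_snd. Qed.

End ContinuousCombinators.

Lemma continuousD_fun {K : numFieldType} {V : normedModType K}
    {U : topologicalType} (f g : U -> V) :
  continuous f -> continuous g -> continuous (fun x => f x + g x).
Proof. by move=> cf cg x; apply: cvgD; [exact: cf|exact: cg]. Qed.

Lemma continuousB_fun {K : numFieldType} {V : normedModType K}
    {U : topologicalType} (f g : U -> V) :
  continuous f -> continuous g -> continuous (fun x => f x - g x).
Proof. by move=> cf cg x; apply: cvgB; [exact: cf|exact: cg]. Qed.

Lemma continuousZ_fun {K : numFieldType} {V : normedModType K}
    {U : topologicalType} (a : U -> K) (f : U -> V) :
  continuous a -> continuous f -> continuous (fun x => a x *: f x).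
Proof. by move=> ca cf x; apply: cvgZ; [exact: ca|exact: cf]. Qed.

Lemma continuousM_fun {K : numFieldType} {U : topologicalType} (f g : U -> K) :
  continuous f -> continuous g -> continuous (fun x => f x * g x).
Proof. by move=> cf cg x; apply: cvgM; [exact: cf|exact: cg]. Qed.

Lemma continuous_mulmx_fun (R : realType) s {U : topologicalType} m n p
  (f : U -> 'M[ground_field R s]_(m, n)) (g : U -> 'M[ground_field R s]_(n, p)) :
  continuous f -> continuous g -> continuous (fun x => f x *m g x).
Proof. by move=> cf cg x; apply: cvg_mulmx; [exact: cf|exact: cg]. Qed.

Section Transport.
Context {R : realType} (s : ground) {T : normedModType R} {X : topologicalType}.
Local Notation K := (ground_field R s).
Context {n : nat}.
Variables (Q : T * X -> 'M[K]_n).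
Hypotheses (Q_continuous : continuous Q) (Q_proj : forall z, is_proj (Q z)).
Hypothesis X_compact : compact [set: X].
Hypothesis T_compact : compact [set t : T | `|t| <= 1].

(** At [h = 0] the matrix is the identity; compactness turns openness of invertibility into one step
    size for all radii, directions and points. *)
Lemma transport_step : exists2 d : R, 0 < d &
  forall (r h : R) t x, 0 <= r <= 1 -> `|h| < d -> `|t| <= 1 ->
    \det (1%:M - Q (r *: t, x) + Q ((r + h) *: t, x)) != 0.
Proof.
pose C := `[0 : R, 1]%classic `*` [set t : T | `|t| <= 1] `*` [set: X].
have cC : compact C.
  by apply: compact_setX => //; apply: compact_setX => //; exact: segment_compact.
pose f (z : R * T * X * R) : 'M[K]_n :=
  1%:M - Q (z.1.1.1 *: z.1.1.2, z.1.2) + Q ((z.1.1.1 + z.2) *: z.1.1.2, z.1.2).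
have cf : continuous f.
  have c1 : continuous (fun z : R * T * X * R => z.1.1.1).
    apply: (continuous_comp_fun continuous_fst).
    by apply: (continuous_comp_fun continuous_fst); exact: continuous_fst.
  have c2 : continuous (fun z : R * T * X * R => z.1.1.2).
    apply: (continuous_comp_fun continuous_snd).
    by apply: (continuous_comp_fun continuous_fst); exact: continuous_fst.
  have c3 : continuous (fun z : R * T * X * R => z.1.2).
    by apply: (continuous_comp_fun continuous_snd); exact: continuous_fst.
  have c4 : continuous (fun z : R * T * X * R => z.2) by exact: continuous_snd.
  apply: continuousD_fun.
    apply: continuousB_fun; first exact: cst_continuous.
    apply: (continuous_comp_fun Q_continuous).
    by apply: continuous_pair_fun => //; exact: continuousZ_fun.
  apply: (continuous_comp_fun Q_continuous).
  apply: continuous_pair_fun => //; apply: continuousZ_fun => //.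
  exact: (@continuousD_fun _ R^o).
move: cC => /compact_near_coveringP cC.
have [] := cC R (nbhs (0 : R)) (fun h y => \det (f (y, h)) != 0) _.
  move=> z _; have : \det (f (z, 0)) != 0.
    by rewrite /f /= addr0 subrK det1 oner_eq0.
  by move=> /(near_det_neq0 (cf (z, 0))).
move=> d /= d0 H; exists d => // r h t x r01 hd t1.
apply: (H h _ (r, t, x)) => //=; first by rewrite sub0r normrN.
Qed.

(** Parallel transport is replaced by finitely many projections: the segment from 0 to [t] is cut
    into [M > 1 / d] steps, and each step projects the frame onto the next subspace without loss of
    rank. *)
Lemma transport N (e : X -> 'M[K]_N) (u : X -> 'M[K]_(N, n)) k :
  continuous u -> (forall x, [/\ e x *m u x = u x, u x *m Q (0, x) = u x
                               & \rank (u x) = k]) ->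
  exists v : T * X -> 'M[K]_(N, n), continuous v /\
    forall t x, `|t| <= 1 -> [/\ e x *m v (t, x) = v (t, x),
      v (t, x) *m Q (t, x) = v (t, x) & \rank (v (t, x)) = k].
Proof.
move=> cu uE; have [d d0 H] := transport_step.
pose M := (Num.truncn d^-1).+1.
have Md : M%:R^-1 < d.
  by rewrite -[ltRHS]invrK ltf_pV2 ?posrE ?invr_gt0//; exact: truncnS_gt.
(* In the first branch [j] is still the successor, so stage [j] lies over [j / M] times [t] and
   stage [M] exactly over [t]. *)
pose fix v j : T * X -> 'M[K]_(N, n) := if j is j'.+1
  then fun z => v j' z *m Q ((j%:R / M%:R) *: z.1, z.2) else fun z => u z.2.
exists (v M); split.
  elim: (M in v M) => [|j ih] /=.
    by apply: (continuous_comp_fun cu); exact: continuous_snd.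
  apply: continuous_mulmx_fun => //; apply: (continuous_comp_fun Q_continuous).
  apply: continuous_pair_fun; last exact: continuous_snd.
  by apply: continuousZ_fun; [exact: cst_continuous|exact: continuous_fst].
move=> t x t1.
suff vE j : (j <= M)%N -> [/\ e x *m v j (t, x) = v j (t, x),
    v j (t, x) *m Q ((j%:R / M%:R) *: t, x) = v j (t, x)
    & \rank (v j (t, x)) = k].
  by have := vE M (leqnn M); rewrite divff ?pnatr_eq0// scale1r.
elim: j => [|j ih] jM /=; first by rewrite mul0r scale0r.
have [v1 v2 v3] := ih (ltnW jM); split.
- by rewrite mulmxA v1.
- by rewrite -mulmxA (Q_proj _).1.
- rewrite (projB_unit_rank v2) ?v3//.
  have -> : j.+1%:R / M%:R = j%:R / M%:R + M%:R^-1 :> R.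
    by rewrite -natr1 mulrDl mul1r.
  apply: H => //; last by rewrite gtr0_norm ?invr_gt0 ?ltr0n.
  by rewrite divr_ge0//= ler_pdivrMr ?ltr0n// mul1r ler_nat ltnW.
Qed.

End Transport.

Section Clamp.
Context {R : realType} {T : normedModType R}.

(** The radial retraction onto the unit ball. Composing with it gives maps on the whole space, whose
    continuity involves no subspace topology. *)
Definition clamp (t : T) : T := (Num.max 1 `|t|)^-1 *: t.

Lemma max1_gt0 (x : R) : 0 < Num.max 1 x.
Proof. by rewrite lt_max ltr01. Qed.

Lemma continuous_norm_fun : continuous (fun t : T => `|t|).
Proof. exact: norm_continuous. Qed.

Lemma continuous_clamp : continuous clamp.
Proof.
move=> t; apply: cvgZ; last exact: cvg_id.
apply: cvgV; first by rewrite gt_eqF ?max1_gt0.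
apply: (@continuous_max R T (fun=> 1) (fun t : T => `|t|)).
  exact: cvg_cst.
exact: continuous_norm_fun.
Qed.

Lemma clamp_id t : `|t| <= 1 -> clamp t = t.
Proof. by move=> t1; rewrite /clamp max_l// invr1 scale1r. Qed.

Lemma norm_clamp t : `|clamp t| <= 1.
Proof.
rewrite /clamp normrZ gtr0_norm ?invr_gt0 ?max1_gt0// mulrC.
by rewrite ler_pdivrMr ?max1_gt0// mul1r le_max lexx orbT.
Qed.

Lemma norm_clamp_ge1 t : 1 <= `|t| -> `|clamp t| = 1.
Proof.
move=> t1; rewrite /clamp max_r// normrZ normfV normr_id mulVf//.
by rewrite gt_eqF// (lt_le_trans ltr01).
Qed.

End Clamp.

Section MatrixApproximation.
Context {R : realType} (s : ground) {T : normedModType R} {X : topologicalType}.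
Local Notation K := (ground_field R s).
Variables (m : nat) (c : X -> 'rV[R]_m).
Hypotheses (c_continuous : continuous c) (c_inj : injective c).
Hypothesis X_compact : compact [set: X].
Hypothesis T_compact : compact [set t : T | `|t| <= 1].

(** Regularity is asked in [x] only. Distances to a fixed parameter, constant in [x], therefore
    belong to [A] and separate parameters, while the coordinates [c] separate points of [X]. *)
Let A : set (T * X -> R) := [set f | continuous f /\
  forall t, rational_on c setT (fun x => f (t, x))].

Let approx (g : T * X -> R) (e : R) : continuous g -> 0 < e ->
  exists2 f, A f & forall t x, `|t| <= 1 -> `|f (t, x) - g (t, x)| < e.
Proof.
move=> cg e0; pose C := [set t : T | `|t| <= 1] `*` [set: X].
have cC : compact C by exact: compact_setX.
have [||||| f Af fg] := @stone_weierstrass R _ C A cC _ _ _ _ _ g e cg e0.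
- by move=> f [].
- by move=> a; split; [exact: cst_continuous|move=> t; exact: rational_cst].
- move=> f h [cf rf] [ch rh]; split; first exact: (@continuousD_fun _ R^o).
  by move=> t; exact: rationalD.
- move=> f h [cf rf] [ch rh]; split; first exact: continuousM_fun.
  by move=> t; exact: rationalM.
- move=> [t x] [t' x'] _ _ txt'x'; have [xx'|xx'] := pselect (x = x').
    exists (fun z => `|z.1 - t|); last first.
      rewrite /= subrr normr0 eq_sym normr_eq0 subr_eq0.
      by apply/eqP => tt'; apply: txt'x'; rewrite tt' xx'.
    split; last by move=> y; exact: (rational_cst c setT `|y - t|).
    apply: (continuous_comp_fun continuous_norm_fun).
    by apply: continuousB_fun; [exact: continuous_fst|exact: cst_continuous].
  have /rowP/existsNP[i /eqP ci] : c x <> c x' by move=> /c_inj.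
  exists (fun z => c z.2 ord0 i) => //; split; last by move=> y; exact: rational_coord.
  apply: (continuous_comp_fun (@coord_continuous R 1 m ord0 i)).
  by apply: (continuous_comp_fun c_continuous); exact: continuous_snd.
by exists f => // t x t1; exact: fg.
Qed.

Lemma matrix_approx N n (g : T * X -> 'M[K]_(N, n)) (e : R) :
  continuous g -> 0 < e ->
  exists v : T * X -> 'M[K]_(N, n), [/\ continuous v,
    forall t, mrational c setT (fun x => v (t, x)) &
    forall t x i j, `|t| <= 1 -> `|repart ((v (t, x) - g (t, x)) i j)| < e /\
      `|impart ((v (t, x) - g (t, x)) i j)| < e].
Proof.
move=> cg e0.
have /choice[f /choice[f' H]] : forall ij, exists f f', [/\ A f, A f' &
    forall t x, `|t| <= 1 ->
    `|f (t, x) - repart (g (t, x) ij.1 ij.2)| < e /\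
    `|f' (t, x) - impart (g (t, x) ij.1 ij.2)| < e].
  move=> [i j] /=.
  have [||f Af fg] := @approx (fun z => repart (g z i j)) e.
  - by move=> z; apply: cvg_re; apply: cvg_entry; exact: cg.
  - by [].
  have [||f' Af' fg'] := @approx (fun z => impart (g z i j)) e.
  - by move=> z; apply: cvg_im; apply: cvg_entry; exact: cg.
  - by [].
  by exists f, f'; split => // t x t1; split; [exact: fg|exact: fg'].
pose v z : 'M[K]_(N, n) := \matrix_(i, j) of_parts s (f (i, j) z) (f' (i, j) z).
have reE z i j : repart (v z i j) = f (i, j) z by rewrite mxE re_of_parts.
have imE z i j : impart (v z i j) = if s is ComplexNumbers then f' (i, j) z else 0.
  by rewrite mxE /of_parts; case: (s).
exists v; split.
- move=> z; apply: cvg_mx => i j.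
  have [[cf _] [cf' _] _] := H (i, j).
  apply: cvg_parts; first by under eq_fun do rewrite reE; rewrite reE; exact: cf.
  under eq_fun do rewrite imE; rewrite imE.
  by case: (s); [exact: cvg_cst|exact: cf'].
- move=> t i j; have [[_ rf] [_ rf'] _] := H (i, j); split.
    by apply: rational_ext (rf t) => x _; rewrite reE.
  suff : rational_on c setT
      (fun x => if s is ComplexNumbers then f' (i, j) (t, x) else 0).
    by apply: rational_ext => x _; rewrite imE.
  by case: (s); [exact: rational_cst|exact: rf'].
- move=> t x i j t1; have [_ _ /(_ t x t1)[h1 h2]] := H (i, j).
  have -> : (v (t, x) - g (t, x)) i j = v (t, x) i j - g (t, x) i j.
    by rewrite [LHS]mxE [X in _ + X]mxE.
  rewrite reD reN imD imN reE imE; split=> //.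
  move: h2 => /=; case: (s) (g) => //= g' _.
  by rewrite subr0 normr0.
Qed.

End MatrixApproximation.

Lemma continuous_mrational (R : realType) (s : ground) (X : topologicalType) m
    (c : X -> 'rV[R]_m) p q (f : X -> 'M[ground_field R s]_(p, q)) :
  continuous c -> mrational c setT f -> continuous f.
Proof.
move=> cc rf x; apply: cvg_mx => i j; have [r1 r2] := rf i j.
by apply: cvg_parts;
  [exact: (continuous_rational cc r1)|exact: (continuous_rational cc r2)].
Qed.

Lemma nbhs0_matrix (R : realType) (s : ground) p q
    (D : set 'M[ground_field R s]_(p, q)) :
  nbhs (0 : 'M[ground_field R s]_(p, q)) D ->
  exists2 e : R, 0 < e & forall M : 'M[ground_field R s]_(p, q),
    (forall i j, `|repart (M i j)| < e /\ `|impart (M i j)| < e) -> D M.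
Proof.
move=> /nbhs_ballP[e /= /[dup] e0 /ground_gt0[d d0 de] H]; exists d => // M Md.
apply: H; split=> // i j; rewrite -ball_normE /= mxE sub0r normrN.
by apply: de; have [] := Md i j.
Qed.

Section Deformation.
Context {R : realType} (s : ground) {T : normedModType R} {X : topologicalType}.
Local Notation K := (ground_field R s).
Variables (m n k N : nat) (c : X -> 'rV[R]_m) (Q : T * X -> 'M[K]_n).
Variables (e : X -> 'M[K]_N) (u0 : X -> 'M[K]_(N, n)).
Hypotheses (c_continuous : continuous c) (c_inj : injective c).
Hypothesis X_compact : compact [set: X].
Hypothesis T_compact : compact [set t : T | `|t| <= 1].
Hypotheses (Q_continuous : continuous Q) (Q_proj : forall z, is_proj (Q z)).
Hypothesis Q_rank : forall z, \rank (Q z) = k.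
Hypothesis Q_sphere : forall t, `|t| = 1 ->
  mrational c setT (fun x => Q (t, x)).
Hypothesis e_rational : mrational c setT e.
Hypotheses (e_proj : forall x, is_proj (e x)) (e_rank : forall x, \rank (e x) = k).
Hypothesis u0_continuous : continuous u0.
Hypothesis u0_frame : forall x, [/\ e x *m u0 x = u0 x,
  u0 x *m Q (0, x) = u0 x & \rank (u0 x) = k].

(** At [r = 1] this doubles and clamps, so that everything of norm at least [1/2] reaches the
    sphere, whose points stay fixed for all [r >= 0]. *)
Let expand (r : R) (t : T) : T := clamp ((1 + r) *: t).

Let expand0 t : `|t| <= 1 -> expand 0 t = t.
Proof. by move=> t1; rewrite /expand addr0 scale1r clamp_id. Qed.

Let expand_sphere r t : `|t| = 1 -> 0 <= r -> expand r t = t.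
Proof.
move=> t1 r0; have r1 : 0 < 1 + r by rewrite ltr_pwDl.
rewrite /expand /clamp normrZ t1 mulr1 gtr0_norm// max_r ?lerDl//.
by rewrite scalerA mulVf ?scale1r// gt_eqF.
Qed.

(* The row space of a perturbation multiplied by [blend (t, x)] lies in that of
   [Q (t, x)] for [t] on the sphere; and [blend (t, _)] is always regular, as
   [expand 1 t] is on the sphere unless [cutoff t] is 1. *)
Let cutoff (t : T) : R := Num.min 1 (2 * (1 - `|t|)).

Let blend (z : T * X) : 'M[K]_n :=
  of_parts s (1 - cutoff z.1) 0 *: Q (expand 1 z.1, z.2) + of_parts s (cutoff z.1) 0 *: 1%:M.

(** The components of [z] are the parameter, the time, the point of [X] and the perturbing matrix.
    The left factor [e] preserves [e *m w = w]; the time factor removes the perturbation at time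
    0. *)
Let frame_perturb (u : T * X -> 'M[K]_(N, n)) (z : T * R * X * 'M[K]_(N, n)) :=
  u (expand z.1.1.2 z.1.1.1, z.1.2) +
  of_parts s z.1.1.2 0 *: (e z.1.2 *m z.2 *m blend (z.1.1.1, z.1.2)).

Let continuous_expand (U : topologicalType) (r : U -> R) (t : U -> T) :
  continuous r -> continuous t -> continuous (fun z => expand (r z) (t z)).
Proof.
move=> cr ct; apply: (continuous_comp_fun continuous_clamp).
apply: continuousZ_fun => //.
by apply: (@continuousD_fun _ R^o) => //; exact: cst_continuous.
Qed.

Let continuous_of_real (U : topologicalType) (r : U -> R) : continuous r ->
  continuous (fun z => of_parts s (r z) 0).
Proof. by move=> cr x; apply: cvg_of_real; exact: cr. Qed.

Let continuous_cutoff : continuous cutoff.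
Proof.
move=> t; apply: (@continuous_min R T (fun=> 1)).
  exact: cst_continuous.
apply: continuousM_fun; first exact: cst_continuous.
apply: (@continuousB_fun _ R^o); first exact: cst_continuous.
exact: continuous_norm_fun.
Qed.

Let continuous_blend : continuous blend.
Proof.
have cc : continuous (fun z : T * X => cutoff z.1).
  by apply: (continuous_comp_fun continuous_cutoff); exact: continuous_fst.
apply: continuousD_fun; apply: continuousZ_fun.
- apply: continuous_of_real; apply: (@continuousB_fun _ R^o) => //.
  exact: cst_continuous.
- apply: (continuous_comp_fun Q_continuous).
  apply: continuous_pair_fun; last exact: continuous_snd.
  by apply: continuous_expand; [exact: cst_continuous|exact: continuous_fst].
- exact: continuous_of_real.
- exact: cst_continuous.
Qed.

Let continuous_frame_perturb u : continuous u -> continuous (frame_perturb u).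
Proof.
move=> cu.
have c1 : continuous (fun z : T * R * X * 'M[K]_(N, n) => z.1.1.1).
  apply: (continuous_comp_fun continuous_fst).
  by apply: (continuous_comp_fun continuous_fst); exact: continuous_fst.
have c2 : continuous (fun z : T * R * X * 'M[K]_(N, n) => z.1.1.2).
  apply: (continuous_comp_fun continuous_snd).
  by apply: (continuous_comp_fun continuous_fst); exact: continuous_fst.
have c3 : continuous (fun z : T * R * X * 'M[K]_(N, n) => z.1.2).
  by apply: (continuous_comp_fun continuous_snd); exact: continuous_fst.
apply: continuousD_fun.
  apply: (continuous_comp_fun cu); apply: continuous_pair_fun => //.
  exact: continuous_expand.
apply: continuousZ_fun; first exact: continuous_of_real.
apply: continuous_mulmx_fun.
  apply: continuous_mulmx_fun; last exact: continuous_snd.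
  apply: (continuous_comp_fun _ c3).
  exact: continuous_mrational c_continuous e_rational.
by apply: (continuous_comp_fun continuous_blend); exact: continuous_pair_fun.
Qed.

Let clamp01 (r : R) : R := Num.max 0 (Num.min 1 r).

Let clamp01_itv r : 0 <= clamp01 r <= 1.
Proof. by rewrite /clamp01 le_max lexx /= ge_max ler01 ge_min lexx. Qed.

Let continuous_clamp01 : continuous clamp01.
Proof.
move=> r; apply: (@continuous_max R R (fun=> 0) (fun r : R => Num.min 1 r)).
  exact: cst_continuous.
by apply: (@continuous_min R R (fun=> 1) id); [exact: cst_continuous|exact: cvg_id].
Qed.

Lemma deformation : exists H : T * R * X -> 'M[K]_n, [/\ continuous H,
  forall z, is_proj (H z) /\ \rank (H z) = k,
  forall t x, `|t| <= 1 -> H (t, 0, x) = Q (t, x),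
  forall t r x, `|t| = 1 -> H (t, r, x) = Q (t, x) &
  forall t, `|t| <= 1 -> mrational c setT (fun x => H (t, 1, x))].
Proof.
have [u [cu uE]] :=
  transport Q_continuous Q_proj X_compact T_compact u0_continuous u0_frame.
have euE r t x : e x *m u (expand r t, x) = u (expand r t, x).
  by have [] := uE (expand r t) x (norm_clamp _).
have uQE r t x : u (expand r t, x) *m Q (expand r t, x) = u (expand r t, x).
  by have [] := uE (expand r t) x (norm_clamp _).
have eW z : e z.1.2 *m frame_perturb u z = frame_perturb u z.
  by rewrite mulmxDr euE -scalemxAr !mulmxA (e_proj _).1.
pose C := [set t : T | `|t| <= 1] `*` `[0 : R, 1]%classic `*` [set: X].
have cC : compact C.
  by apply: compact_setX => //; apply: compact_setX => //; exact: segment_compact.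
(* For [M = 0] the frame is a transported one, of rank [k], whose Gram matrix is invertible;
   compactness of [C] makes the admissible size of [M] uniform. *)
have [d d0 dH] : exists2 d : R, 0 < d & forall M : 'M[K]_(N, n),
    (forall i j, `|repart (M i j)| < d /\ `|impart (M i j)| < d) ->
    forall t r x, `|t| <= 1 -> 0 <= r <= 1 ->
    \det (gram (e x) (frame_perturb u (t, r, x, M))) != 0.
  move: cC => /compact_near_coveringP cC.
  have ce : continuous e by exact: continuous_mrational c_continuous e_rational.
  have cG : continuous (fun z => gram (e z.1.2) (frame_perturb u z)).
    have ce2 : continuous (fun z : T * R * X * 'M[K]_(N, n) => e z.1.2).
      apply: (continuous_comp_fun ce).
      by apply: (continuous_comp_fun continuous_snd); exact: continuous_fst.
    by move=> z; apply: cvg_gram; [exact: ce2|exact: continuous_frame_perturb].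
  have /nbhs0_matrix[d d0 H] : nbhs (0 : 'M[K]_(N, n)) (fun M =>
      C `<=` (fun y => \det (gram (e y.2) (frame_perturb u (y, M))) != 0)).
    apply: (cC _ (nbhs (0 : 'M[K]_(N, n)))
      (fun M y => \det (gram (e y.2) (frame_perturb u (y, M))) != 0)).
    move=> [[t r] x] [[/= t1 _] _].
    apply: (near_det_neq0 (cG (t, r, x, 0))) => /=.
    rewrite /frame_perturb /= mulmx0 mul0mx scaler0 addr0.
    apply: gram_unit; rewrite ?euE// e_rank.
    by have [] := uE (expand r t) x (norm_clamp _).
  exists d => // M /H CM t r x t1 r01; apply: (CM (t, r, x)).
  by rewrite /C /= in_itv.
have cg : continuous (fun z : T * X => u (expand 1 z.1, z.2)).
  apply: (continuous_comp_fun cu).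
  apply: continuous_pair_fun; last exact: continuous_snd.
  by apply: continuous_expand; [exact: cst_continuous|exact: continuous_fst].
have [v [cv rv vg]] := matrix_approx c_continuous c_inj X_compact T_compact cg d0.
pose D (z : T * X) := v z - u (expand 1 z.1, z.2).
(* Clamping both parameters keeps the Gram matrix invertible on all of [T * R * X], so that [H] is
   continuous everywhere. *)
pose W (z : T * R * X) :=
  frame_perturb u (clamp z.1.1, clamp01 z.1.2, z.2, D (clamp z.1.1, z.2)).
pose H z := row_proj (e z.2) (W z).
have dW z : \det (gram (e z.2) (W z)) != 0.
  apply: dH; [|exact: norm_clamp|exact: clamp01_itv].
  by move=> i j; apply: vg; exact: norm_clamp.
have eWz z : e z.2 *m W z = W z.
  exact: (eW (clamp z.1.1, clamp01 z.1.2, z.2, D (clamp z.1.1, z.2))).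
have HQ (z : T * R * X) q : W z *m Q q = W z -> H z = Q q.
  by move=> WQ; apply: row_proj_eq => //; rewrite Q_rank e_rank.
exists H; split.
- apply: continuous_row_proj => //.
    apply: (continuous_comp_fun _ continuous_snd).
    exact: continuous_mrational c_continuous e_rational.
  have c1 : continuous (fun z : T * R * X => clamp z.1.1).
    apply: (continuous_comp_fun continuous_clamp).
    by apply: (continuous_comp_fun continuous_fst); exact: continuous_fst.
  have c2 : continuous (fun z : T * R * X => clamp01 z.1.2).
    apply: (continuous_comp_fun continuous_clamp01).
    by apply: (continuous_comp_fun continuous_snd); exact: continuous_fst.
  apply: (continuous_comp_fun (continuous_frame_perturb cu)).
  apply: continuous_pair_fun.
    apply: continuous_pair_fun; last exact: continuous_snd.
    exact: continuous_pair_fun.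
  apply: (continuous_comp_fun (f := fun z : T * R * X => (clamp z.1.1, z.2)) (g := D)).
    exact: continuousB_fun.
  by apply: continuous_pair_fun => //; exact: continuous_snd.
- move=> z; split; first exact: row_proj_proj.
  by rewrite row_proj_eqmx// (rank_gram_unit (e_proj z.2)).
- move=> t x t1; apply: HQ.
  have c0 : clamp01 0 = 0 by rewrite /clamp01 min_r ?ler01// maxxx.
  rewrite /W /frame_perturb /= c0 of_parts0 scale0r addr0 clamp_id//.
  rewrite -[in Q _](expand0 t1).
  by rewrite uQE.
- move=> t r x t1; apply: HQ.
  have t1' : `|t| <= 1 by rewrite t1.
  have := clamp01_itv r; rewrite /W /frame_perturb /= clamp_id// => /andP[r0 _].
  rewrite mulmxDl -{2}(expand_sphere t1 r0) uQE; congr (_ + _).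
  rewrite -scalemxAl -!mulmxA; congr (_ *: (_ *m (_ *m _))).
  have -> : blend (t, x) = Q (t, x); last by rewrite (Q_proj _).1.
  rewrite /blend /= expand_sphere// /cutoff t1 subrr mulr0 min_r ?ler01// subr0.
  by rewrite of_parts0 of_parts1 scale1r scale0r addr0.
- move=> t t1; apply: mrational_row_proj => //.
  have c1 : clamp01 1 = 1 by rewrite /clamp01 minxx max_r.
  (* At time 1 the non-regular frame cancels: [u (expand 1 t, x)] is fixed by [blend], whose two
     weights add up to 1, so [u + e (v - u) blend = e v blend]. *)
  have WE x : e x *m v (t, x) *m blend (t, x) = W (t, 1, x).
    rewrite /W /frame_perturb /= c1 of_parts1 scale1r clamp_id// /D /=.
    rewrite mulmxBr mulmxBl euE.
    suff -> : u (expand 1 t, x) *m blend (t, x) = u (expand 1 t, x).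
      by rewrite addrC subrK.
    rewrite /blend /= mulmxDr -!scalemxAr uQE mulmx1 -scalerDl.
    rewrite (_ : _ + _ = 1) ?scale1r//.
    apply: parts_inj; rewrite ?reD ?imD ?re_of_parts ?im_of_parts0 ?re1 ?im1.
      by rewrite subrK.
    by rewrite addr0.
  apply: mrational_ext (fun x _ => WE x) _.
  apply: mrational_mulmx; first exact: mrational_mulmx.
  (* The norm [1/2] is both where [cutoff] leaves the value 1 and where [expand 1] reaches the
     sphere. *)
  have [t2|t2] := leP `|t| 2^-1.
    have : mrational c setT (fun _ : X => 1%:M : 'M[K]_n) by exact: mrational_cst.
    apply: mrational_ext => x _; rewrite /blend /=.
    have -> : cutoff t = 1 by rewrite /cutoff min_l//; lra.
    by rewrite subrr of_parts0 of_parts1 scale1r scale0r add0r.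
  rewrite /blend /=; apply: mrationalD; apply: mrationalZ; last exact: mrational_cst.
  apply: Q_sphere; apply: norm_clamp_ge1; rewrite normrZ ger0_norm; lra.
Qed.

End Deformation.

(** * Spaces of maps *)

Lemma compact_set_type (V : topologicalType) (A : set V) :
  compact A -> compact [set: A].
Proof.
move=> /compact_near_coveringP cA; apply/compact_near_coveringP => J F P FF H.
have : \near F, A `<=` (fun y => forall x : A, set_val x = y -> P F x).
  apply: (cA _ _ (fun i y => forall x : A, set_val x = y -> P i x)) => y Ay.
  have [[U W] /= [Uy FW] UW] := H (exist _ y (mem_set Ay)) I.
  case: Uy => _ [ [D oD <-] /= Dy] DU.
  exists (D, W) => /=; first by split=> //; exact: open_nbhs_nbhs.
  move=> [z i] [/= Dz Wi] x xz; apply: (UW (x, i)); split => //=.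
  by apply: DU => /=; rewrite xz.
by apply: filterS => i Ai x _; apply: (Ai (set_val x)) => //; exact: set_valP.
Qed.

Lemma hausdorff_set_type (V : topologicalType) (A : set V) :
  hausdorff_space V -> hausdorff_space A.
Proof.
move=> hV p q pq; apply: val_inj; apply: hV => U W Up Wq.
have [x [Ux Wx]] := pq _ _ (continuous_set_val Up) (continuous_set_val Wq).
by exists (set_val x).
Qed.

Section MapTopology.
Context {X Y : topologicalType}.

Lemma Map_eq (f g : Map X Y) : (forall x, f x = g x) -> f = g.
Proof.
move=> fg; have : fun_of_Map f = fun_of_Map g by exact/funext.
case: f g {fg} => f [[cf]] [g [[cg]]] /=; rewrite /fun_of_Map /= => fg.
by move: cf cg; rewrite fg => cf cg; rewrite (Prop_irrelevance cf cg).
Qed.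

Definition Map_of (f : X -> Y) (cf : continuous f) : Map X Y :=
  HB.pack f (isContinuous.Build X Y f cf).

Lemma continuous_Map (f : Map X Y) : continuous f.
Proof. by case: f => f [[cf]]. Qed.

Lemma continuous_to_Map (U : topologicalType) (f : U * X -> Y)
    (cf : continuous f) (g : U -> Map X Y) :
  (forall u x, g u x = f (u, x)) -> continuous g.
Proof.
move=> gf u.
have := (continuous_curry cf).1 u.
have -> : curry f = fun u => fun_of_Map (g u).
  by apply/funext => u'; apply/funext => x; rewrite gf.
move=> H W [_ [ [D oD <-] /= Du] DW].
have /H : nbhs (fun_of_Map (g u) : {compact-open, X -> Y}) D by exact: open_nbhs_nbhs.
by rewrite !nbhs_simpl /fmap /=; apply: filterS => z Dz; exact: DW.
Qed.

(** This half of the exponential law rests on local compactness of the source, here a consequence of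
    compactness. *)
Lemma continuous_of_Map (U : topologicalType) (g : U -> Map X Y) :
  compact [set: X] -> hausdorff_space X -> continuous g ->
  continuous (fun z : U * X => g z.1 z.2).
Proof.
move=> cX hX cg.
have lX : locally_compact [set: X].
  by move=> x _; exists setT; [exact: filterT|split=> //; exact: closedT].
have cg' : continuous (fun u => fun_of_Map (g u) : {compact-open, X -> Y}).
  move=> u; apply: continuous_comp; first exact: cg.
  exact: initial_continuous.
have -> : (fun z : U * X => g z.1 z.2) = uncurry (fun u => fun_of_Map (g u)).
  by apply/funext => -[].
exact: (continuous_uncurry lX hX cg' (fun u => @continuous_Map (g u))).
Qed.

End MapTopology.

Section MapDeformation.
Context {R : realType} (s : ground) (m n k : nat) (X : set 'rV[R]_m).
Local Notation K := (ground_field R s).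
Local Notation G := (grassmannian R s n k).
Hypothesis X_compact : compact X.
Hypothesis X_bundles :
  forall (T : topologicalType) (xi : vfamily (ground_field R s) T X),
     topological_bundle k xi ->
     exists (E : fspace R) (eta : vfamily (ground_field R s) (euclidean E) X),
       algebraic_bundle k eta /\ topologically_isomorphic xi eta.

Let grass_proj (P : G) : is_proj (set_val P).
Proof. by have [? ? ?] := set_valP P. Qed.

Let grass_rank (P : G) : \rank (set_val P) = k.
Proof. by have [] := set_valP P. Qed.

Let to_grass (P : 'M[K]_n) (h : is_proj P /\ \rank P = k) : G.
Proof. by exists P; apply/mem_set; case: h => -[? ?] ?; split. Defined.

(* [a] and [b] identify the parameter space [C] with the unit ball of [T]. *)
Lemma map_deformation (T : normedModType R) (Z : topologicalType) (C : set Z)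
    (a : Z -> T) (b : T -> Z) (F : Z -> Map X G) :
  compact [set t : T | `|t| <= 1] -> continuous a -> continuous b ->
  (forall z, C z -> `|a z| <= 1) -> (forall t, `|t| <= 1 -> C (b t)) ->
  (forall z, b (a z) = z) ->
  {within C, continuous F} ->
  (forall z, C z -> `|a z| = 1 -> Alg s X n k (F z)) ->
  (forall t, a (b t) = t) ->
  exists (H : Z * R -> Map X G) (A : Z -> Alg s X n k),
    [/\ continuous H, continuous A,
      forall z, C z -> H (z, 0) = F z,
      forall z r, C z -> `|a z| = 1 -> H (z, r) = F z &
      forall z, C z -> set_val (A z) = H (z, 1)].
Proof.
move=> cB ca cb aC bC ba cF FA ab.
have cX := compact_set_type X_compact.
have hX : hausdorff_space X by apply: hausdorff_set_type; exact: norm_hausdorff.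
(* [F] is continuous only within [C]; precomposing with [clamp] extends its restriction to all of
   [T]. *)
pose F' (t : T) : Map X G := F (b (clamp t)).
have cF' : continuous F'.
  pose q (t : T) : C := exist _ (b (clamp t)) (mem_set (bC _ (norm_clamp t))).
  have cq : continuous q.
    move=> t; apply: cvg_set_val.
    exact: (continuous_comp_fun cb continuous_clamp).
  move/subspace_sigL_continuousP : cF => cF.
  exact: (continuous_comp_fun cF cq).
pose Q (z : T * X) : 'M[K]_n := set_val (F' z.1 z.2).
have cQ : continuous Q.
  apply: (continuous_comp_fun (@continuous_set_val _ G)).
  exact: continuous_of_Map.
(* The hypothesis on bundles is applied to the single map at the center of the ball; transport
   reaches all the others. *)
have [N [e [u [re cu eu]]]] := algebraic_model X_bundles
  (continuous_comp_fun (@continuous_set_val _ G) (@continuous_Map _ _ (F' 0)))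
  (fun x => grass_proj _) (fun x => grass_rank _).
have [|H [cH Hp H0 Hs H1]] := @deformation R s T X m n k N set_val Q e u
  (@continuous_set_val _ X) val_inj cX cB cQ (fun z => grass_proj _)
  (fun z => grass_rank _) _ re (fun x => let: And5 h _ _ _ _ := eu x in h)
  (fun x => let: And5 _ h _ _ _ := eu x in h) cu
  (fun x => let: And5 _ _ h1 h2 h3 := eu x in And3 h1 h2 h3).
  move=> t t1 i j; have bt : C (b t) by apply: bC; rewrite t1.
  have [] := FA _ bt _ i j; first by rewrite ab.
  by rewrite /Q /F' /= clamp_id ?t1.
have cg : continuous (fun z => to_grass (Hp z)).
  by move=> z; apply: cvg_set_val; exact: cH.
have cgz (p : T * R) : continuous (fun x : X => to_grass (Hp (p, x))).
  apply: (continuous_comp_fun cg); apply: continuous_pair_fun.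
    exact: cst_continuous.
  by move=> x; exact: cvg_id.
pose HM (p : T * R) : Map X G := Map_of (cgz p).
have cHM : continuous HM by apply: (continuous_to_Map cg).
have HA t : `|t| <= 1 -> Alg s X n k (HM (t, 1)).
  by move=> t1 i j; exact: (H1 t t1 i j).
(* [A] has to take values in [Alg] even outside of [C], hence the clamp. *)
pose A (z : Z) : Alg s X n k :=
  exist _ (HM (clamp (a z), 1)) (mem_set (HA _ (norm_clamp _))).
exists (fun z => HM (a z.1, z.2)), A; split.
- apply: (continuous_comp_fun cHM).
  apply: continuous_pair_fun; last exact: continuous_snd.
  by apply: (continuous_comp_fun ca); exact: continuous_fst.
- move=> z; apply: cvg_set_val.
  suff : continuous (fun z => HM (clamp (a z), 1)) by exact.
  apply: (continuous_comp_fun cHM); apply: continuous_pair_fun.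
    exact: (continuous_comp_fun continuous_clamp ca).
  exact: cst_continuous.
- move=> z Cz; apply: Map_eq => x; apply: val_inj => /=.
  by rewrite H0 ?aC// /Q /F' /= clamp_id ?aC// ba.
- move=> z r Cz az; apply: Map_eq => x; apply: val_inj => /=.
  by rewrite Hs// /Q /F' /= clamp_id ?az// ba.
- move=> z Cz; suff : HM (clamp (a z), 1) = HM (a z, 1) by [].
  by rewrite clamp_id// aC.
Qed.

End MapDeformation.

(** * Cubes as unit balls of maximum norms *)

Section Cubes.
Context {R : realType}.

Lemma rV_normE n (t : 'rV[R]_n) :
  `|t| = \big[Num.max/0]_(ij : 'I_1 * 'I_n) `|t ij.1 ij.2|.
Proof. exact: mx_normrE. Qed.

Lemma rV_norm_le1 n (t : 'rV[R]_n) :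
  `|t| <= 1 <-> forall i, `|t ord0 i| <= 1.
Proof.
rewrite rV_normE; split=> [/bigmax_leP[_ H] i|H].
  exact: (H (ord0, i)).
by apply/bigmax_leP; split=> // -[i j] _ /=; rewrite ord1.
Qed.

Lemma rV_norm_eq1 n (t : 'rV[R]_n) : `|t| = 1 -> exists i, `|t ord0 i| = 1.
Proof.
move=> t1; have [|[i j] ] := @mx_norm_neq0 _ _ _ t.
  by rewrite -[mx_norm t]/(`|t|) t1 oner_neq0.
by rewrite -[mx_norm t]/(`|t|) t1 /= ord1 => h; exists j; rewrite -h.
Qed.

Lemma rV_ball_compact n : compact [set t : 'rV[R]_n | `|t| <= 1].
Proof.
have -> : [set t : 'rV[R]_n | `|t| <= 1] =
    [set t : 'rV[R]_n | forall i, `[-1, 1]%classic (t ord0 i)].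
  apply/seteqP; split=> t /= => [/rV_norm_le1 H i|H].
    by rewrite in_itv /= -ler_norml.
  by apply/rV_norm_le1 => i; rewrite ler_norml; have := H i; rewrite in_itv.
by apply: (@rV_compact R n (fun=> `[-1, 1]%classic)) => _; exact: segment_compact.
Qed.

Lemma R_ball_compact : compact [set t : R | `|t| <= 1].
Proof.
have -> : [set t : R | `|t| <= 1] = `[-1, 1]%classic.
  by apply/seteqP; split=> t /=; rewrite in_itv /= ler_norml.
exact: segment_compact.
Qed.

(** Because products carry the maximum norm too, a cube times an interval is again a unit ball. *)
Lemma prod_norm_max (U V : normedModType R) (z : U * V) :
  `|z| = Num.max `|z.1| `|z.2|.
Proof. by []. Qed.

Lemma prod_norm_le1 (U V : normedModType R) (z : U * V) :
  (`|z| <= 1) = (`|z.1| <= 1) && (`|z.2| <= 1).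
Proof. by rewrite prod_norm_max ge_max. Qed.

Lemma prod_norm_eq1 (U V : normedModType R) (z : U * V) : `|z| = 1 ->
  `|z.1| = 1 \/ `|z.2| = 1.
Proof. by rewrite prod_norm_max; case: leP => _ ->; [right|left]. Qed.

Lemma prod_ball_compact (U V : normedModType R) :
  compact [set t : U | `|t| <= 1] -> compact [set t : V | `|t| <= 1] ->
  compact [set t : U * V | `|t| <= 1].
Proof.
move=> cU cV; have := compact_setX cU cV.
congr compact; apply/seteqP; split=> -[t r]; rewrite /= prod_norm_le1 /=.
  by move=> [-> ->].
by move=> /andP[].
Qed.

(** It carries [[0, 1]^n] onto [[-1, 1]^n], the unit ball of the maximum norm, so that no comparison
    with round balls is needed. *)
Definition center_rV n (t : 'rV[R]_n) : 'rV[R]_n := 2 *: t - const_mx 1.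
Definition uncenter_rV n (t : 'rV[R]_n) : 'rV[R]_n := 2^-1 *: (t + const_mx 1).
Definition center (t : R) : R := 2 * t - 1.
Definition uncenter (t : R) : R := 2^-1 * (t + 1).

Lemma center_rVE n (t : 'rV[R]_n) i : center_rV t ord0 i = center (t ord0 i).
Proof. by rewrite !mxE. Qed.

Lemma uncenter_rVE n (t : 'rV[R]_n) i : uncenter_rV t ord0 i = uncenter (t ord0 i).
Proof. by rewrite !mxE. Qed.

Lemma centerK : cancel center uncenter.
Proof. by move=> t; rewrite /center /uncenter; field. Qed.

Lemma uncenterK : cancel uncenter center.
Proof. by move=> t; rewrite /center /uncenter; field. Qed.

Lemma center_rVK n : cancel (@center_rV n) (@uncenter_rV n).
Proof. by move=> t; apply/rowP => i; rewrite uncenter_rVE center_rVE centerK. Qed.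

Lemma uncenter_rVK n : cancel (@uncenter_rV n) (@center_rV n).
Proof. by move=> t; apply/rowP => i; rewrite center_rVE uncenter_rVE uncenterK. Qed.

Lemma center_le1 t : (`|center t| <= 1) = (0 <= t <= 1).
Proof. by rewrite ler_norml /center; apply/andP/andP => -[]; split; lra. Qed.

Lemma center_eq1 t : `|center t| = 1 -> t = 0 \/ t = 1.
Proof.
by rewrite /center; case: (ger0P (2 * t - 1)) => h e; [right|left]; lra.
Qed.

Lemma center_rV_le1 n (t : 'rV[R]_n) : `|center_rV t| <= 1 <-> cube t.
Proof.
rewrite rV_norm_le1; split=> H i; have := H i; rewrite center_rVE center_le1//.
Qed.

Lemma center_rV_eq1 n (t : 'rV[R]_n) :
  `|center_rV t| = 1 -> cube_boundary t.
Proof.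
move=> t1; split; first by apply/center_rV_le1; rewrite t1.
by have [i] := rV_norm_eq1 t1; rewrite center_rVE => /center_eq1; exists i.
Qed.

Lemma cube_boundary_center n (t : 'rV[R]_n) :
  cube_boundary t -> `|center_rV t| = 1.
Proof.
move=> [/center_rV_le1 t1 [i ti]]; apply: le_anti; rewrite t1 /=.
have -> : 1 = `|center_rV t ord0 i|.
  by rewrite center_rVE /center; case: ti => ->;
    rewrite ?mulr0 ?sub0r ?normrN ?mulr1 ?addrK normr1.
rewrite rV_normE.
exact: (le_bigmax _ (fun ij : 'I_1 * 'I_n => `|center_rV t ij.1 ij.2|) (ord0, i)).
Qed.

Lemma continuous_center_rV n : continuous (@center_rV n).
Proof.
apply: continuousB_fun; last exact: cst_continuous.
by apply: continuousZ_fun; [exact: cst_continuous|move=> x; exact: cvg_id].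
Qed.

Lemma continuous_uncenter_rV n : continuous (@uncenter_rV n).
Proof.
apply: continuousZ_fun; first exact: cst_continuous.
by apply: continuousD_fun; [move=> x; exact: cvg_id|exact: cst_continuous].
Qed.

Lemma continuous_center : continuous center.
Proof.
apply: (@continuousB_fun _ R^o); last exact: cst_continuous.
by apply: continuousM_fun; [exact: cst_continuous|move=> x; exact: cvg_id].
Qed.

Lemma continuous_uncenter : continuous uncenter.
Proof.
apply: continuousM_fun; first exact: cst_continuous.
by apply: (@continuousD_fun _ R^o); [move=> x; exact: cvg_id|exact: cst_continuous].
Qed.

End Cubes.

Lemma continuous_reverse (R : realType) (Z W : topologicalType)
    (H : Z * R -> W) : continuous H -> continuous (fun z : Z * R => H (z.1, 1 - z.2)).
Proof.
move=> cH; apply: (continuous_comp_fun cH); apply: continuous_pair_fun.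
  exact: continuous_fst.
by apply: (@continuousB_fun _ R^o); [exact: cst_continuous|exact: continuous_snd].
Qed.

Theorem theorem2p1 (R : realType) (s : ground) (m n k : nat)
  (X : set 'rV[R]_m)
  (X_algebraic : algebraic_set X)
  (X_compact : compact X)
  (X_bundles : forall (T : topologicalType) (xi : vfamily (ground_field R s) T X),
     topological_bundle k xi ->
     exists (E : fspace R) (eta : vfamily (ground_field R s) (euclidean E) X),
       algebraic_bundle k eta /\ topologically_isomorphic xi eta) :
  weak_homotopy_equivalence R
    (set_val : Alg s X n k -> Map X (grassmannian R s n k)).
Proof.
have deform := map_deformation X_compact X_bundles (n := n).
split.
- exact: continuous_set_val.
(* A point is the unit ball of the zero space, and its sphere is empty. *)
- move=> b.
  have id_cont : continuous (id : 'rV[R]_0 -> 'rV[R]_0) by move=> x; exact: cvg_id.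
  have [||||||H [A [cH _ H0 _ H1]]] := deform 'rV[R]_0 'rV[R]_0 setT id id (fun=> b)
    (@rV_ball_compact R 0) id_cont id_cont.
  + by move=> z _; apply/rV_norm_le1 => -[].
  + by [].
  + by [].
  + by apply: continuous_subspaceT; exact: cst_continuous.
  + by move=> z _ /rV_norm_eq1[[]].
  + by [].
  (* The deformation runs from the given map into [Alg], whereas the clause asks for a path in the
     other direction. *)
  exists (A 0), (fun r => H (0, 1 - r)); split.
  + apply: continuous_subspaceT.
    apply: (continuous_comp_fun (f := fun r : R => (0 : 'rV[R]_0, r))
      (continuous_reverse cH)).
    by apply: continuous_pair_fun; [exact: cst_continuous|move=> x; exact: cvg_id].
  + by rewrite subr0 H1.
  + by rewrite subrr H0.
(* A path is a one-dimensional ball with algebraic endpoints; the last stage of its deformation is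
   the path sought in [Alg]. *)
- move=> a a' [p [cp p0 p1]].
  have [||||||H [A [_ cA _ HA H1]]] := deform R^o R `[0, 1]%classic center uncenter p
    R_ball_compact continuous_center continuous_uncenter.
  + by move=> z; rewrite /= in_itv /= center_le1.
  + by move=> t; rewrite /= in_itv /= -center_le1 uncenterK.
  + exact: centerK.
  + exact: cp.
  + by move=> z _ /center_eq1[] ->; rewrite ?p0 ?p1; exact: set_valP.
  + exact: uncenterK.
  have AE (r : R) : r = 0 \/ r = 1 -> set_val (A r) = p r.
    move=> r01; have Cr : `[0, 1]%classic r.
      by case: r01 => ->; rewrite /= in_itv /= lexx ler01.
    rewrite H1// HA//; case: r01 => ->; rewrite /center ?mulr0 ?mulr1.
      by rewrite sub0r normrN normr1.
    by rewrite addrK normr1.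
  exists A; split.
  + exact: continuous_subspaceT.
  + by apply: val_inj; apply: etrans (AE 0 _) p0; left.
  + by apply: val_inj; apply: etrans (AE 1 _) p1; right.
(* The domain of the homotopy is a ball of dimension [d + 1]. Its sphere consists of the sides, sent
   to the base point, and of the two ends, where the homotopy is [u] and [v]; all these values are
   algebraic. *)
- move=> d a u v d0 [_ ua] [_ va] [H [cH Hu Hv Ha]].
  pose cen (z : 'rV[R]_d * R) : 'rV[R]_d * R := (center_rV z.1, center z.2).
  pose unc (z : 'rV[R]_d * R) : 'rV[R]_d * R := (uncenter_rV z.1, uncenter z.2).
  have ccen : continuous cen.
    apply: continuous_pair_fun.
      apply: (continuous_comp_fun (@continuous_center_rV R d)).
      exact: continuous_fst.
    by apply: (continuous_comp_fun continuous_center); exact: continuous_snd.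
  have cunc : continuous unc.
    apply: continuous_pair_fun.
      apply: (continuous_comp_fun (@continuous_uncenter_rV R d)).
      exact: continuous_fst.
    by apply: (continuous_comp_fun continuous_uncenter); exact: continuous_snd.
  have cenC (z : 'rV[R]_d * R) : (@cube R d `*` `[0, 1]%classic) z <-> `|cen z| <= 1.
    rewrite prod_norm_le1 /= center_le1 in_itv /=; split.
      by move=> [/center_rV_le1 -> ->].
    by move=> /andP[/center_rV_le1].
  have cenK : cancel cen unc by move=> [t r]; rewrite /cen /unc /= center_rVK centerK.
  have uncK : cancel unc cen.
    by move=> [t r]; rewrite /cen /unc /= uncenter_rVK uncenterK.
  have [||||||F [A [_ cA _ HA H1]]] := deform ('rV[R]_d * R^o)%type ('rV[R]_d * R)%type
    (@cube R d `*` `[0, 1]%classic) cen unc H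
    (prod_ball_compact (@rV_ball_compact R d) R_ball_compact) ccen cunc.
  + by move=> z /cenC.
  + by move=> t t1; apply/cenC; rewrite uncK.
  + exact: cenK.
  + exact: cH.
  + move=> [t r] [/= Ct Cr] /prod_norm_eq1[/center_rV_eq1 bt|/center_eq1 /= r01].
      have r01 : 0 <= r <= 1 by move: Cr; rewrite in_itv.
      by rewrite (Ha t r bt r01); exact: set_valP.
    by case: r01 => ->; rewrite ?(Hu t Ct) ?(Hv t Ct); exact: set_valP.
  + exact: uncK.
  have AE t r : cube t -> 0 <= r <= 1 -> [\/ cube_boundary t, r = 0 | r = 1] ->
      set_val (A (t, r)) = H (t, r).
    move=> Ct r01 b; have C1 : (@cube R d `*` `[0, 1]%classic) (t, r).
      by split => //=; rewrite in_itv.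
    rewrite H1// HA//; apply: le_anti; rewrite (cenC _).1//=.
    rewrite prod_norm_max le_max /=; case: b => [/cube_boundary_center ->|->|->].
    * by rewrite lexx.
    * by rewrite /center mulr0 sub0r normrN normr1 lexx orbT.
    * by rewrite /center mulr1 addrK normr1 lexx orbT.
  exists A; split.
  + exact: continuous_subspaceT.
  + move=> t Ct; apply: val_inj; apply: etrans (AE t 0 Ct _ _) (Hu t Ct).
      by rewrite lexx ler01.
    by constructor 2.
  + move=> t Ct; apply: val_inj; apply: etrans (AE t 1 Ct _ _) (Hv t Ct).
      by rewrite lexx ler01.
    by constructor 3.
  + move=> t r bt r01; have Ct : cube t by case: bt.
    apply: val_inj; apply: etrans (AE t r Ct r01 _) (Ha t r bt r01).
    by constructor 1.
(* The whole sphere is sent to the algebraic base point, so the deformation is based: its end is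
   [u], and its reversal the homotopy from [u] to [w]. *)
- move=> d a w d0 [cw wa].
  have [||||||H [A [cH cA H0 HA H1]]] := deform 'rV[R]_d 'rV[R]_d (@cube R d)
    (@center_rV R d) (@uncenter_rV R d) w (@rV_ball_compact R d)
    (@continuous_center_rV R d) (@continuous_uncenter_rV R d).
  + by move=> z /center_rV_le1.
  + by move=> t t1; apply/center_rV_le1; rewrite uncenter_rVK.
  + exact: center_rVK.
  + exact: cw.
  + by move=> z Cz /center_rV_eq1 /wa ->; exact: set_valP.
  + exact: uncenter_rVK.
  exists A; split.
    split; first exact: continuous_subspaceT.
    move=> t bt; have Ct : cube t by case: bt.
    apply: val_inj; apply: etrans (H1 t Ct) _.
    by rewrite HA// ?cube_boundary_center// wa.
  exists (fun z => H (z.1, 1 - z.2)); split.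
  + by apply: continuous_subspaceT; exact: continuous_reverse.
  + by move=> t Ct /=; rewrite subr0 H1.
  + by move=> t Ct /=; rewrite subrr H0.
  + move=> t r bt r01 /=; have Ct : cube t by case: bt.
    by rewrite HA// ?cube_boundary_center// wa.
Qed.
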